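(* For every $n\ge 4$, the four binary matrices $\mathcal{S}^{\{(n,n)\}}(\mathbf{M}_n)$, $\mathcal{S}^{G_{n-1}}(\mathbf{H}_{n-1})$, $\mathcal{S}^{Q_n}(\mathbf{D}_n)$ and $\mathcal{S}^{Q_{n+1}}(\mathbf{T}_{n+1})$ are minimally non-firm. Moreover, $\mathcal{S}^{Q_n}(\mathbf{D}_n)$ and $\mathcal{S}^{Q_{n+1}}(\mathbf{T}_{n+1})$ are totally balanced.
   Context: For a binary matrix $\mathbf{X}$, $\mathrm{supp}(\mathbf{X})=\{(i,j):x_{i,j}=1\}$; a submatrix is obtained by deleting rows and columns, and is proper if it omits at least one row or column; a rectangle is a set $I\times J\subseteq\mathrm{supp}(\mathbf{X})$; an isolated set is a subset of $\mathrm{supp}(\mathbf{X})$ no two distinct elements of which lie in a common rectangle; $i(\mathbf{X})$ is the maximum size of an isolated set; $br(\mathbf{X})$ is the minimum number of rectangles whose union is $\mathrm{supp}(\mathbf{X})$. $\mathbf{X}$ is minimally non-firm if $i(\mathbf{X})<br(\mathbf{X})$ and $i(\mathbf{X}')=br(\mathbf{X}')$ for every proper submatrix $\mathbf{X}'$. A binary matrix is totally balanced if it has no submatrix which, after permuting rows and columns, equals $\mathbf{C}_t$ for some $t\ge3$. Stretching: for $\mathbf{X}\in\{0,1\}^{m\times n}$ and nonempty $Q=\{(\ell_1,k_1),\dots,(\ell_q,k_q)\}\subseteq\mathrm{supp}(\mathbf{X})$ in lexicographic order, $\mathcal{S}^Q(\mathbf{X})$ is the $(m+q)\times(n+q)$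 binary matrix with top-left block $\mathbf{X}$, entries at $(\ell_t,n+t)$, $(m+t,k_t)$, $(m+t,n+t)$ equal to $1$ for $t\in[q]$, all other entries $0$. Matrices: for $t\ge3$, $\mathbf{C}_t\in\{0,1\}^{t\times t}$ has $1$s exactly at $(i,i),(i,i+1)$ for $i\in[t-1]$ and at $(t,1),(t,t)$. For $n\ge4$, $\mathbf{M}_n:=\mathcal{S}^{\{(n-1,n-1)\}}(\mathbf{C}_{n-1})\in\{0,1\}^{n\times n}$. For $t\ge3$, $\mathbf{H}_t:=[\mathbf{1},\mathbf{C}_t]\in\{0,1\}^{t\times(t+1)}$ (first column all ones, followed by $\mathbf{C}_t$) and $G_t:=\{(t,2),(t,t+1)\}$. For $n\ge4$, $\mathbf{D}_n\in\{0,1\}^{n\times n}$ has $1$s exactly at $(1,2),(1,3),(2,1),(2,2),(2,3)$, at $(3,j)$ for all $j\in[n]$, and at $(i,i-1),(i,i)$ for $4\le i\le n$ (equivalently $\mathbf{D}_4=\begin{bmatrix}0&1&1&0\\1&1&1&0\\1&1&1&1\\0&0&1&1\end{bmatrix}$ and $\mathbf{D}_n=\mathcal{S}^{\{(3,n-1)\}}(\mathbf{D}_{n-1})$). For $n\ge5$, $\mathbf{T}_n\in\{0,1\}^{n\times n}$ has $1$s exactly at $(1,2),(1,4),(2,1),(2,3),(3,2),(3,3),(3,4),(4,1),(4,3)$, at $(4,j)$ for $4\le j\le n$, and at $(i,i-1),(i,i)$ for $5\le i\le n$ (equivalently $\mathbf{T}_n=\mathcal{S}^{\{(4,n-1)\}}(\mathbf{T}_{n-1})$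 for $n\ge6$). $Q_n:=\{(1,2),(2,1),(n,n)\}$. *)

(* Defs.v *)
From mathcomp Require Import all_boot ssralg matrix.
Set Implicit Arguments. Unset Strict Implicit. Unset Printing Implicit Defensive.

(* Binary matrices are 'M[bool]_(m, n); rows/columns 1..m / 1..n of the paper
   correspond to ordinals 0..m-1 / 0..n-1. *)

Section Generic.
Variables m n : nat.
Implicit Type X : 'M[bool]_(m, n).

Definition supp X : {set 'I_m * 'I_n} := [set p | X p.1 p.2].

Definition is_rect X (I : {set 'I_m}) (J : {set 'I_n}) : bool :=
  setX I J \subset supp X.

Definition common_rect X (a b : 'I_m * 'I_n) : bool :=
  [exists I : {set 'I_m}, exists J : {set 'I_n},
     [&& is_rect X I J, a \in setX I J & b \in setX I J]].

Definition isolated X (A : {set 'I_m * 'I_n}) : bool :=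
  (A \subset supp X) &&
  [forall a in A, forall b in A, (a != b) ==> ~~ common_rect X a b].

Definition iso_num X : nat := \max_(A : {set 'I_m * 'I_n} | isolated X A) #|A|.

Definition rect_cover X (F : {set {set 'I_m} * {set 'I_n}}) : bool :=
  [forall p in F, is_rect X p.1 p.2] &&
  (supp X == \bigcup_(p in F) setX p.1 p.2).

Definition coverable X (k : nat) : bool :=
  [exists F : {set {set 'I_m} * {set 'I_n}}, rect_cover X F && (#|F| == k)].

Lemma coverable_ex X : exists k, coverable X k.
Proof.
set F := [set ([set x.1], [set x.2]) | x in supp X].
exists #|F|; apply/existsP; exists F; rewrite eqxx andbT.
apply/andP; split.
  apply/forallP => p; apply/implyP => /imsetP [x xX ->] /=.
  apply/subsetP => y; case: y => y1 y2; rewrite in_setX !in_set1 => /andP [/eqP -> /eqP ->].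
  by case: x xX.
apply/eqP/setP => y; apply/idP/idP.
  move=> yX; apply/bigcupP; exists ([set y.1], [set y.2]); first by apply/imsetP; exists y.
  by case: y {yX} => y1 y2; rewrite in_setX !in_set1 !eqxx.
case/bigcupP => p /imsetP [x xX ->] /=.
by case: y => y1 y2; rewrite in_setX !in_set1 => /andP [/eqP -> /eqP ->]; case: x xX.
Qed.

Definition br_num X : nat := ex_minn (coverable_ex X).

Definition submx X (R : {set 'I_m}) (C : {set 'I_n}) : 'M[bool]_(#|R|, #|C|) :=
  \matrix_(i < #|R|, j < #|C|) X (enum_val i) (enum_val j).

End Generic.

Definition minimally_non_firm m n (X : 'M[bool]_(m, n)) : Prop :=
  iso_num X < br_num X /\
  forall (R : {set 'I_m}) (C : {set 'I_n}),
    (R != setT) || (C != setT) -> iso_num (submx X R C) = br_num (submx X R C).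


Definition mxof m n (f : nat -> nat -> bool) : 'M[bool]_(m, n) :=
  \matrix_(i < m, j < n) f i.+1 j.+1.

Definition Cf (t : nat) (i j : nat) : bool :=
  ((1 <= i <= t.-1) && ((j == i) || (j == i.+1))) || ((i == t) && ((j == 1) || (j == t))).

Definition Cmx (t : nat) : 'M[bool]_(t, t) := mxof t t (Cf t).

Definition totally_balanced m n (X : 'M[bool]_(m, n)) : Prop :=
  ~ exists t, exists (f : 'I_t -> 'I_m) (g : 'I_t -> 'I_n),
      [/\ 3 <= t, injective f, injective g & forall i j, X (f i) (g j) = Cmx t i j].

(* Stretching, on 1-indexed functions: Q is the list (l_1,k_1),...,(l_q,k_q)
   in lexicographic order, X is m x n. *)
Definition stretchf (m n : nat) (Q : seq (nat * nat)) (f : nat -> nat -> bool)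
  (i j : nat) : bool :=
  let q := size Q in
  if i <= m then
    (if j <= n then f i j else (j - n <= q) && ((nth (0, 0) Q (j - n).-1).1 == i))
  else
    (i - m <= q) &&
    (if j <= n then (nth (0, 0) Q (i - m).-1).2 == j else j - n == i - m).

Definition stretch m n (Q : seq (nat * nat)) (f : nat -> nat -> bool)
  : 'M[bool]_(m + size Q, n + size Q) := mxof _ _ (stretchf m n Q f).

Definition Mf (n : nat) : nat -> nat -> bool :=
  stretchf n.-1 n.-1 [:: (n.-1, n.-1)] (Cf n.-1).

(* H_t = [1, C_t] (t x (t+1)) *)
Definition Hf (t : nat) (i j : nat) : bool := if j == 1 then true else Cf t i j.-1.

Definition Gs (t : nat) : seq (nat * nat) := [:: (t, 2); (t, t.+1)].

Definition Df (n : nat) (i j : nat) : bool :=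
  [|| (i == 1) && ((j == 2) || (j == 3)),
      (i == 2) && (1 <= j <= 3),
      (i == 3) && (1 <= j <= n)
    | (4 <= i <= n) && ((j == i.-1) || (j == i))].

Definition Tf (n : nat) (i j : nat) : bool :=
  [|| (i == 1) && ((j == 2) || (j == 4)),
      (i == 2) && ((j == 1) || (j == 3)),
      (i == 3) && ((j == 2) || (j == 3) || (j == 4)),
      (i == 4) && ((j == 1) || (j == 3) || (4 <= j <= n))
    | (5 <= i <= n) && ((j == i.-1) || (j == i))].

Definition Qs (n : nat) : seq (nat * nat) := [:: (1, 2); (2, 1); (n, n)].

(* Main.v *)
Require Import Defs.
From Stdlib Require Import Classical.
From mathcomp Require Import all_boot ssralg matrix zify.

Set Implicit Arguments. Unset Strict Implicit. Unset Printing Implicit Defensive.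

(* Join two cells of a binary matrix when they lie in a common rectangle. Cliques of
   this graph are contained in rectangles, so i(X) is its independence number, br(X)
   its clique cover number, and submatrices are induced subgraphs. Call a set of cells
   good if the two numbers agree on it. If the cells minus the closed neighbourhood of
   a simplicial cell are good, so are the cells, and the same holds for the gap between
   the two numbers. Eliminating the corner cells of a stretching merely removes the
   cells of Q from those to be covered, so everything happens in the unstretched matrix.

   In a fan, a missing row or column starts a cascade of simplicial eliminations that
   consumes the fan, while an intact tail can be shortened step by step, by contracting
   an induced path on three cells to one cell. This reduces D_n and T_n to matrices of
   bounded size, which are checked by computation. M_n and H_t carry a closed wheel. If
   a line of its rim is missing, two fans remain; if the rim is complete, explicit
   isolated sets meet explicit covers by full lines. Their gap comes from an odd hole. *)

(** * Independent sets and clique covers *)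

(** The induction cannot stay within submatrices: peeling a corner leaves a submatrix some of whose
    ones are marked. A marked cell is no longer a vertex, but it is still a one and so may lie
    inside a rectangle. Every statement therefore ranges over the kept rows, the kept columns and
    the marked cells. Exactly one configuration carries the gap: all lines kept and all of [Q]
    marked. All others must be good, so what each reduction has to preserve is that something is
    missing. The obstacle is a complete tail whose end cell [(t, t)] is marked. Elimination cannot
    start there: [(t, t - 1)] has the nonadjacent neighbours [(s, t)] and [(t - 1, t - 1)], where
    [s] is the hub row. Hence the contraction, which raises both numbers by one and moves the mark
    from one end cell to the previous one, so that it carries goodness and the gap alike. Transposed
    and relabelled, the matrices of both wheel families sit in one pattern: its row 0 is the hub
    that only [H_t] has, and its row 1 and column 1 are the lines that only [M_n] has. Rims are thus
    treated once for both. *)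

Lemma addn_excl3 (a b d : bool) (i j l : nat) :
  ~~ (a && b) -> ~~ (a && d) -> ~~ (b && d) ->
  [|| a, b | d] + (i + j + l) = (a + i) + (b + j) + (d + l).
Proof. lia. Qed.

Section CliqueCover.
Variables (T : eqType) (adj : rel T).
Implicit Types (U : pred T) (A : seq T) (col : T -> nat).

Definition indep A := {in A &, forall x y, x != y -> ~~ adj x y}.

(* A clique cover by [k] cliques, encoded by the index of the clique of each vertex. *)
Definition coloring U k col :=
  (forall x, U x -> col x < k) /\
  (forall x y, U x -> U y -> col x = col y -> adj x y).

(** By weak duality an independent set and a clique cover of equal size are both optimal, so these
    two witnesses replace any reference to extrema. *)
Definition good U := exists A col,
  [/\ uniq A, (forall x, x \in A -> U x), indep A & coloring U (size A) col].

(** A threshold [k] that separates the two numbers; neither of them has to be computed. *)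
Definition gap U := exists k,
  (forall A, uniq A -> (forall x, x \in A -> U x) -> indep A -> size A <= k) /\
  (forall col, ~ coloring U k col).

Lemma good_ext U V : U =1 V -> good U -> good V.
Proof.
move=> UV [A [col [uA AU iA [c1 c2]]]]; exists A, col; split=> //.
  by move=> x xA; rewrite -UV; apply: AU.
by split=> [x|x y]; rewrite -!UV; [apply: c1 | apply: c2].
Qed.

Lemma gap_ext U V : U =1 V -> gap U -> gap V.
Proof.
move=> UV [k [ak ck]]; exists k; split=> [A uA AV iA|col [c1 c2]].
  by apply: ak => // x /AV; rewrite UV.
by apply: (ck col); split=> [x|x y]; rewrite !UV; [apply: c1|apply: c2].
Qed.

Hypothesis adjC : symmetric adj.

(** The closed neighbourhood of [e] is a clique: [e] joins the independent set, and one new colour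
    pays for the whole neighbourhood. *)
Lemma good_simplicial U V e :
  U e -> adj e e ->
  (forall x y, U x -> U y -> adj e x -> adj e y -> adj x y) ->
  (forall x, V x = U x && ~~ adj e x) -> good V -> good U.
Proof.
move=> Ue ee simp VE [A [col [uA AV iA [c1 c2]]]].
have eA x : x \in A -> ~~ adj e x by move/AV; rewrite VE => /andP[].
exists (e :: A), (fun x => if adj e x then size A else col x); split.
- by rewrite /= uA andbT; apply/negP => /eA; rewrite ee.
- by move=> x; rewrite inE => /predU1P[-> //|/AV]; rewrite VE => /andP[].
- move=> x y; rewrite !inE => /predU1P[->|xA] /predU1P[->|yA]; first by rewrite eqxx.
  + by move=> _; apply: eA.
  + by move=> _; rewrite adjC; apply: eA.
  + exact: iA.
- split=> [x Ux|x y Ux Uy] /=.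
    by case: ifP => [//|/negbT ex]; rewrite ltnW // ltnS c1 // VE Ux.
  have lt z : U z -> adj e z = false -> col z < size A.
    by move=> Uz /negbT ez; apply: c1; rewrite VE Uz.
  case: ifP => ex; case: ifP => ey.
  + by move=> _; apply: simp.
  + by move=> E; have := lt _ Uy ey; rewrite -E ltnn.
  + by move=> E; have := lt _ Ux ex; rewrite E ltnn.
  + by apply: c2; rewrite VE ?Ux ?Uy ?ex ?ey.
Qed.

Lemma coloring_merge U k col c :
  c <= k -> (forall x, U x -> col x != c) -> coloring U k.+1 col ->
  coloring U k (fun x => if col x == k then c else col x).
Proof.
move=> ck nc [c1 c2]; split=> [x Ux|x y Ux Uy].
  rewrite /=; case: eqP => [E|/eqP xk]; last by rewrite ltn_neqAle xk -ltnS c1.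
  by rewrite ltn_neqAle ck andbT -E eq_sym; apply: nc.
move=> E; apply: c2 => //; move: E => /=; case: eqP => [->|_]; case: eqP => [->|_] // E.
  by have := nc _ Uy; rewrite E eqxx.
by have := nc _ Ux; rewrite E eqxx.
Qed.

(** An independent set has at most one element in the closed neighbourhood of [e]. In a colouring,
    the colour of [e] occurs only in that neighbourhood, hence is free on [V]. *)
Lemma gap_simplicial U V e :
  U e -> adj e e ->
  (forall x y, U x -> U y -> adj e x -> adj e y -> adj x y) ->
  (forall x, V x = U x && ~~ adj e x) -> gap V -> gap U.
Proof.
move=> Ue ee simp VE [k [ak ck]]; exists k.+1; split=> [A uA AU iA|col].
  have le1 : size (filter (adj e) A) <= 1.
    have : uniq (filter (adj e) A) by rewrite filter_uniq.
    have sub x : x \in filter (adj e) A -> adj e x /\ x \in A.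
      by rewrite mem_filter => /andP.
    case: (filter _ _) sub => [//|x [//|y s]] sub /=; rewrite !inE => /andP[/norP[xy _] _].
    have [ex xA] := sub x (mem_head _ _).
    have [ey yA] : adj e y /\ y \in A by apply: sub; rewrite !inE eqxx orbT.
    by have := iA _ _ xA yA xy; rewrite simp //; apply: AU.
  have H := ak (filter (predC (adj e)) A).
  rewrite -(count_predC (adj e) A) -!size_filter -add1n leq_add // H ?filter_uniq //.
    by move=> x; rewrite mem_filter /= => /andP[nx /AU Ux]; rewrite VE Ux.
  by move=> x y; rewrite !mem_filter => /andP[_ xA] /andP[_ yA]; apply: iA.
move=> [c1 c2].
apply: (ck (fun x => if col x == k then col e else col x)).
apply: coloring_merge; first by rewrite -ltnS c1.
  move=> x; rewrite VE => /andP[Ux]; apply: contra => /eqP E.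
  by apply: c2.
by split=> [x|x y]; rewrite !VE => /andP[Ux _]; [apply: c1 | move=> /andP[Uy _]; apply: c2].
Qed.

Section Contract.
Variables (U V : pred T) (p p2 q s : T).
Hypotheses (adjxx : forall x, V x -> adj x x).
Hypotheses (Up : U p) (Up2 : ~~ U p2) (Uq : ~~ U q) (Us : ~~ U s).
Hypotheses (p2q : p2 != q) (p2s : p2 != s) (qs : q != s).
Hypothesis VE : forall x, V x = [|| U x, x == p2, x == q | x == s].
Hypotheses (Np2 : forall x, U x -> adj p2 x -> adj p x).
Hypotheses (Nq : forall x, U x -> adj q x -> adj p x).
Hypotheses (Ns : forall x, U x -> adj s x -> x = p).
Hypotheses (nqp2 : ~~ adj q p2) (aqs : adj q s) (asp2 : adj s p2).
Hypothesis dich : forall x y, U x -> U y -> adj p x -> adj p y -> adj x y ->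
  adj p2 x || adj q y.

Let UV x : U x -> V x. Proof. by rewrite VE => ->. Qed.
Let Vp2 : V p2. Proof. by rewrite VE eqxx !orbT. Qed.
Let Vq : V q. Proof. by rewrite VE eqxx !orbT. Qed.
Let Vs : V s. Proof. by rewrite VE eqxx !orbT. Qed.

(* The path [p2 - s - q] behaves like the single vertex [p]: a clique through [p]
   extends by [p2] or by [q], and the two other new vertices form a clique. *)
Lemma good_contract : good U -> good V.
Proof.
move=> [A [col [uA AU iA [c1 c2]]]].
have nU x : x \in A -> [/\ x != p2, x != q & x != s].
  by move=> /AU Ux; split; apply: contraTneq Ux => ->.
(* If [p] is in [A], it is exchanged for the two ends [p2] and [q] of the path; otherwise the middle
   vertex [s], whose only neighbour in [U] is [p], is added. *)
have [A' [uA' A'V iA' sA']] : exists A', [/\ uniq A', forall x, x \in A' -> V x,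
    indep A' & size A' = (size A).+1].
  case pA: (p \in A).
    exists [:: p2, q & rem p A]; split.
    - rewrite /= rem_uniq // andbT !inE (negPf p2q) /=.
      by apply/andP; split; apply/negP => /mem_rem /nU[]; rewrite eqxx.
    - by move=> x; rewrite !inE => /or3P[/eqP->|/eqP->|/mem_rem /AU /UV].
    - have pr x : x \in rem p A -> U x /\ ~~ adj p x.
        rewrite mem_rem_uniq // inE => /andP[xp xA]; split; first exact: AU.
        by rewrite iA // eq_sym.
      have pr2 x : x \in rem p A -> ~~ adj p2 x /\ ~~ adj q x.
        by move/pr => [Ux nx]; split; apply: contra nx; [apply: Np2|apply: Nq].
      move=> x y; rewrite !inE.
      move=> /or3P[/eqP->|/eqP->|xA] /or3P[/eqP->|/eqP->|yA]; rewrite ?eqxx //.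
      + by rewrite adjC.
      + by case: (pr2 _ yA).
      + by case: (pr2 _ yA).
      + by rewrite adjC; case: (pr2 _ xA).
      + by rewrite adjC; case: (pr2 _ xA).
      + by apply: iA; apply: mem_rem; [exact: xA|exact: yA].
    - by rewrite /= size_rem // prednK // -has_predT; apply/hasP; exists p.
  exists (s :: A); split=> //=.
  - by rewrite uA andbT; apply/negP => /nU[]; rewrite eqxx.
  - by move=> x; rewrite inE => /predU1P[->//|/AU/UV].
  - have sr x : x \in A -> ~~ adj s x.
      by move=> xA; apply/negP => /(Ns (AU _ xA)) E; rewrite E pA in xA.
    move=> x y; rewrite !inE => /predU1P[->|xA] /predU1P[->|yA]; rewrite ?eqxx //.
    + by move=> _; apply: sr.
    + by move=> _; rewrite adjC; apply: sr.
    + exact: iA.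
(* The end [a] joins the colour class of [p], and the edge between [b] and [s] takes the new colour
   [size A]. *)
have key (a b : T) : (forall x, U x -> col x = col p -> adj a x) ->
    [/\ V a, V b, ~~ U a & ~~ U b] -> adj s b -> b != s -> a != b -> a != s ->
    (forall x, V x = [|| U x, x == a, x == b | x == s]) -> good V.
  move=> Ha [Va Vb nUa nUb] sb bs ab as_ VE'.
  exists A', (fun x => if x == a then col p else if U x then col x else size A).
  split=> //; rewrite sA'; split=> [x Vx|x y Vx Vy] /=.
    case: eqP => _; first by rewrite ltnW // ltnS c1.
    by case: ifP => // Ux; rewrite ltnW // ltnS c1.
  have lt z : U z -> col z < size A by apply: c1.
  have aa : a == a by [].
  move: (lt _ Up); move: Vx Vy; rewrite !VE'.
  case: (eqVneq x a) => [->|xa]; case: (eqVneq y a) => [->|ya].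
  - by move=> _ _ _ _; apply: adjxx.
  - case: (boolP (U y)) => [Uy _ _ _ E|_ _ _]; first by apply: Ha.
    by move=> H E; rewrite E ltnn in H.
  - case: (boolP (U x)) => [Ux _ _ _ E|_ _ _]; first by rewrite adjC; apply: Ha.
    by move=> H E; rewrite E ltnn in H.
  - case: (boolP (U x)) => Ux; case: (boolP (U y)) => Uy.
    + by move=> _ _ _; apply: c2.
    + by move=> _ _ _ E; have := lt _ Ux; rewrite E ltnn.
    + by move=> _ _ _ E; have := lt _ Uy; rewrite E ltnn.
    + by rewrite /= => /orP[]/eqP-> /orP[]/eqP-> _ _; rewrite ?(adjC b s) ?sb //; apply: adjxx.
(* If some [x] in the class of [p] misses [p2], then [dich] applied to this [x] and any other member
   shows that the whole class sees [q]. *)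
case: (classic (forall x, U x -> col x = col p -> adj p2 x)) => [H2|nH2].
  apply: (key p2 q) => //; first by rewrite adjC.
have {}nH2 : exists x, [/\ U x, col x = col p & ~~ adj p2 x].
  apply: NNPP => H; apply: nH2 => x Ux Ex; apply/negPn/negP => nx.
  by apply: H; exists x.
case: nH2 => x [Ux Ex nx]; apply: (key q p2) => //; last 2 first.
- by rewrite eq_sym.
- by move=> y; rewrite VE; case: (y == p2); case: (y == q); rewrite ?orbT.
move=> y Uy Ey; have := dich Ux Uy; rewrite (negPf nx) /= => -> //; apply: c2 => //.
by rewrite Ex.
Qed.

(** An independent set uses two of the three new vertices only if it contains both [p2] and [q], and
    these may then be replaced by [p]. As [p2] and [q] are not adjacent, one of them differs in
    colour from [s]; giving its colour to [p] frees the colour of [s]. *)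
Lemma gap_contract : adj s p -> gap U -> gap V.
Proof.
move=> asp [k [ak ck]]; exists k.+1; split=> [A uA AV iA|col].
  have sub (B : seq T) : uniq B -> {subset B <= A} -> (forall x, x \in B -> U x) ->
      size B <= k.
    by move=> uB BA BU; apply: ak => // x y xB yB; apply: iA; apply: BA.
  pose B := filter U A.
  have uB : uniq B by rewrite filter_uniq.
  have BA : {subset B <= A} by move=> x; rewrite mem_filter => /andP[].
  have BU x : x \in B -> U x by rewrite mem_filter => /andP[].
  have sA : size A = (size B + ((p2 \in A) + (q \in A) + (s \in A)))%N.
    rewrite /B size_filter -(count_predC U A); congr (_ + _).
    have -> : count (predC U) A = count (fun x => [|| x == p2, x == q | x == s]) A.
      apply: eq_in_count => x /AV; rewrite VE /=.
      case: (boolP (U x)) => //= Ux _; symmetry; apply/negbTE/negP.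
      by move=> /or3P[]/eqP E; move: Ux; rewrite E; apply/negP.
    transitivity (count (pred1 p2) A + count (pred1 q) A + count (pred1 s) A); last first.
      by rewrite !count_uniq_mem.
    elim: A {uA AV iA sub B uB BA BU} => //= x A ->.
    apply: addn_excl3; apply/andP => -[/eqP-> H].
    - by move: p2q; rewrite H.
    - by move: p2s; rewrite H.
    - by move: qs; rewrite H.
  have kB : size B <= k by apply: sub.
  have ns : s \in A -> p2 \notin A /\ q \notin A.
    move=> sA'; split; apply/negP => zA; first by have := iA _ _ sA' zA; rewrite eq_sym p2s asp2 => /(_ isT).
    by have := iA _ _ zA sA'; rewrite qs aqs => /(_ isT).
  case sA': (s \in A).
    have [/negPf n1 /negPf n2] := ns sA'.
    by rewrite sA n1 n2 sA' addn1 ltnS.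
  case p2A: (p2 \in A); case qA: (q \in A); rewrite sA sA' p2A qA ?addn0 ?addn1 ?ltnS //; last exact: leqW.
  (* By [dich] with both arguments equal, every neighbour of [p] in [U] sees [p2] or [q]. *)
  have npB x : x \in B -> ~~ adj p x.
    move=> xB; apply/negP => px; have Ux := BU _ xB.
    have xA := BA _ xB.
    have := dich Ux Ux px px (adjxx (UV Ux)).
    case/orP => H.
      have := iA _ _ p2A xA; rewrite H => /(_ _)/negP; apply=> //.
      by apply: contraNneq Up2 => ->.
    have := iA _ _ qA xA; rewrite H => /(_ _)/negP; apply=> //.
    by apply: contraNneq Uq => ->.
  have app : adj p p by apply/adjxx/UV.
  suff : size (p :: B) <= k by rewrite /= addn2 ltnS.
  apply: ak => /=.
  - by rewrite uB andbT; apply/negP => /npB; rewrite app.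
  - by move=> x; rewrite inE => /predU1P[->//|/BU].
  - move=> x y; rewrite !inE => /predU1P[->|xB] /predU1P[->|yB]; rewrite ?eqxx //.
    + by move=> _; apply: npB.
    + by move=> _; rewrite adjC; apply: npB.
    + by apply: iA; apply: BA.
move=> [c1 c2].
have key a : V a -> col a != col s -> (forall x, U x -> adj a x -> adj p x) -> False.
  move=> Va ac Na; pose col' x := if x == p then col a else col x.
  apply: (ck (fun x => if col' x == k then col s else col' x)).
  apply: coloring_merge; first by rewrite -ltnS c1.
    move=> x Ux; rewrite /col'; case: (eqVneq x p) => [_ //|xp].
    apply: contra xp => /eqP E; apply/eqP/Ns => //; apply: c2 => //; exact: UV.
  split=> [x Ux|x y Ux Uy]; rewrite /col'.
    by case: ifP => _; apply: c1 => //; apply: UV.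
  case: (eqVneq x p) => [->|_]; case: (eqVneq y p) => [->|_] E.
  - exact/adjxx/UV.
  - by apply: Na => //; apply: c2 => //; apply: UV.
  - by rewrite adjC; apply: Na => //; apply: c2 => //; apply: UV.
  - by apply: c2 => //; apply: UV.
case: (eqVneq (col p2) (col s)) => E2; last exact: key E2 Np2.
case: (eqVneq (col q) (col s)) => Eq; last exact: key Eq Nq.
by have := nqp2; rewrite c2 // Eq E2.
Qed.

End Contract.

(** Under [k] colours, let [K] be the colour class of [e]. An independent set of size [k] outside
    [K] uses [k] further colours, one too many. *)
Lemma gap_intro U k e :
  (forall A, uniq A -> (forall x, x \in A -> U x) -> indep A -> size A <= k) ->
  U e ->
  (forall K : pred T, (forall x, K x -> U x) -> (forall x y, K x -> K y -> adj x y) ->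
     K e -> exists A, [/\ uniq A, forall x, x \in A -> U x && ~~ K x, indep A & size A = k]) ->
  gap U.
Proof.
move=> ak Ue H; exists k; split=> // col [c1 c2].
have [||//|A [uA AU iA sA]] := H (fun x => U x && (col x == col e)).
- by move=> x /andP[].
- by move=> x y /andP[Ux /eqP Ex] /andP[Uy /eqP Ey]; apply: c2; rewrite ?Ex.
- by rewrite Ue eqxx.
have : uniq (map col (e :: A)).
  rewrite /= map_inj_in_uniq ?uA ?andbT.
    apply/negP => /mapP[x /AU /andP[Ux]]; rewrite Ux /= => nx E.
    by rewrite E eqxx in nx.
  move=> x y xA yA E; apply/eqP/negPn/negP => xy.
  have := iA _ _ xA yA xy; rewrite c2 //.
    by case/andP: (AU _ xA).
  by case/andP: (AU _ yA).
move=> uM; suff : size (map col (e :: A)) <= k by rewrite size_map /= sA ltnn.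
rewrite -(size_iota 0 k); apply: uniq_leq_size uM _ => _ /mapP[x xA ->]; rewrite mem_iota /= c1 //.
by move: xA; rewrite inE => /predU1P[->//|/AU /andP[]].
Qed.

(* Each clique contains at most two elements of [E], so [size E] cannot be covered
   by [k] cliques when [size E = 2k + 1]. *)
Lemma gap_intro_triple U k (E : seq T) :
  (forall A, uniq A -> (forall x, x \in A -> U x) -> indep A -> size A <= k) ->
  (forall x, x \in E -> U x) -> uniq E -> size E = k.*2.+1 ->
  {in E & &, forall x y z, x != y -> x != z -> y != z ->
     ~~ [&& adj x y, adj x z & adj y z]} ->
  gap U.
Proof.
move=> ak EU uE sE tri; exists k; split=> // col [c1 c2].
have cnt i : count (fun x => col x == i) E <= 2.
  rewrite -size_filter.
  have : uniq (filter (fun x => col x == i) E) by rewrite filter_uniq.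
  have sub x : x \in filter (fun x => col x == i) E -> col x = i /\ x \in E.
    by rewrite mem_filter => /andP[/eqP].
  case: (filter _ _) sub => [//|x [//|y [//|z t]]] sub /=.
  rewrite !inE !negb_or => /and3P[/and3P[xy xz _] /andP[yz _] _].
  have [Ex xE] : col x = i /\ x \in E by apply: sub; rewrite !inE eqxx.
  have [Ey yE] : col y = i /\ y \in E by apply: sub; rewrite !inE eqxx orbT.
  have [Ez zE] : col z = i /\ z \in E by apply: sub; rewrite !inE eqxx !orbT.
  have := tri _ _ _ xE yE zE xy xz yz.
  by rewrite !c2 ?Ex ?Ey ?Ez //; apply: EU.
have : forall m, count (fun x => col x < m) E <= m.*2.
  elim=> [|m IH]; first by rewrite (eq_count (a2 := pred0)) ?count_pred0.
  rewrite (eq_count (a2 := predU (fun x => col x < m) (fun x => col x == m))).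
    by have := count_predUI (fun x => col x < m) (fun x => col x == m) E; have := cnt m; lia.
  by move=> x /=; rewrite ltnS leq_eqVlt orbC.
move/(_ k); have -> : count (fun x => col x < k) E = size E; last by rewrite sE; lia.
by apply/eqP; rewrite -all_count; apply/allP => x /EU /c1.
Qed.

End CliqueCover.

Section Transport.
Variables (T1 T2 : eqType) (adj1 : rel T1) (adj2 : rel T2).
Variables (U1 : pred T1) (U2 : pred T2) (h : T2 -> T1).
Hypotheses (hU : forall x, U2 x -> U1 (h x)).
Hypotheses (hadj : forall x y, U2 x -> U2 y -> adj1 (h x) (h y) = adj2 x y).

Lemma good_transport : (forall y, U1 y -> exists2 x, U2 x & h x = y) ->
  good adj1 U1 -> good adj2 U2.
Proof.
move=> hsurj [A [col [uA AU iA [c1 c2]]]].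
have [B BU hB] : exists2 B, (forall x, x \in B -> U2 x) & map h B = A.
  elim: A AU {uA iA c1} => [|a A IH] AU; first by exists [::].
  have [x Ux hx] := hsurj a (AU a (mem_head _ _)).
  have [|B BU hB] := IH; first by move=> y yA; apply: AU; rewrite inE yA orbT.
  exists (x :: B); last by rewrite /= hx hB.
  by move=> y; rewrite inE => /predU1P[->//|/BU].
have uB : uniq (map h B) by rewrite hB.
exists B, (col \o h); split=> //.
- exact: map_uniq uB.
- move=> x y xB yB xy; rewrite -hadj ?BU //; apply: iA; rewrite -?hB ?map_f //.
  apply: contra xy => /eqP E; apply/eqP.
  have: index (h x) (map h B) = index (h y) (map h B) by rewrite E.
  have H z : z \in B -> nth x B (index (h z) (map h B)) = z.
    move=> zB; have i : index z B < size B by rewrite index_mem.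
    by rewrite -{1}(nth_index x zB) -(nth_map x (h x)) // index_uniq ?size_map // nth_index.
  by move=> E'; rewrite -(H _ xB) E' H.
- rewrite -(size_map h) hB; split=> [x /hU/c1 //|x y Ux Uy /= E].
  by rewrite -hadj //; apply: c2 => //; apply: hU.
Qed.

(** Vertices with the same image under [h] are adjacent by reflexivity, so [h] is injective on
    independent sets and preserves their size. *)
Lemma gap_transport (h' : T1 -> T2) :
  (forall x, U2 x -> adj2 x x) ->
  (forall y, U1 y -> U2 (h' y) /\ h (h' y) = y) ->
  gap adj1 U1 -> gap adj2 U2.
Proof.
move=> refl2 h'U [k [ak ck]]; exists k; split=> [A uA AU iA|col [c1 c2]].
  rewrite -(size_map h); apply: ak.
  - rewrite map_inj_in_uniq // => x y xA yA E; apply/eqP/negPn/negP => xy.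
    have := iA _ _ xA yA xy; rewrite -hadj ?AU // E hadj ?AU ?refl2 //; exact: AU.
  - by move=> _ /mapP[x xA ->]; apply/hU/AU.
  - move=> _ _ /mapP[x xA ->] /mapP[y yA ->] xy; rewrite hadj ?AU //.
    by apply: iA => //; apply: contra xy => /eqP->.
apply: (ck (col \o h')); split=> [y /h'U[Uy _]|y z Uy Uz /= E]; first exact: c1.
have [[Vy hy] [Vz hz]] := (h'U _ Uy, h'U _ Uz).
by rewrite -hy -hz hadj //; apply: c2.
Qed.

End Transport.

(** * From matrices to graphs of cells *)

Section Bridge.
Variables (m n : nat) (X : 'M[bool]_(m, n)).
Implicit Types (x y : 'I_m * 'I_n) (A : {set 'I_m * 'I_n}).
Implicit Types (F : {set {set 'I_m} * {set 'I_n}}).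

Definition rect_adj x y := X x.1 y.2 && X y.1 x.2.

Lemma mem_supp x : (x \in supp X) = X x.1 x.2.
Proof. by rewrite inE. Qed.

Lemma common_rectP x y : x \in supp X -> y \in supp X ->
  common_rect X x y = rect_adj x y.
Proof.
rewrite !mem_supp => Xx Xy; apply/existsP/andP.
  case=> I /existsP[J /and3P[/subsetP IJ]].
  rewrite !inE => /andP[x1 x2] /andP[y1 y2].
  have := (IJ (x.1, y.2), IJ (y.1, x.2)).
  by rewrite !inE /= x1 x2 y1 y2 => -[/(_ isT) -> /(_ isT) ->].
case=> Xxy Xyx; exists [set x.1; y.1]; apply/existsP; exists [set x.2; y.2].
rewrite !inE !eqxx !orbT /= andbT.
by apply/subsetP => -[i j]; rewrite !inE /= => /andP[/orP[]/eqP-> /orP[]/eqP->].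
Qed.

Lemma isolated_card A F : isolated X A -> rect_cover X F -> #|A| <= #|F|.
Proof.
move=> /andP[/subsetP AX /forallP iA] /andP[/forallP rF /eqP cF].
pose f x := odflt (set0, set0) [pick p in F | x \in setX p.1 p.2].
have fP x : x \in A -> f x \in F /\ x \in setX (f x).1 (f x).2.
  move=> /AX; rewrite cF => /bigcupP[p pF xp]; rewrite /f.
  by case: pickP => [q /andP[]//|/(_ p)]; rewrite pF xp.
have fi : {in A &, injective f}.
  move=> x y xA yA E; apply/eqP/negPn/negP => xy.
  have := iA x; rewrite xA => /forallP/(_ y); rewrite yA xy /= => /negP; apply.
  have [fF xf] := fP _ xA; have [_ yf] := fP _ yA.
  apply/existsP; exists (f x).1; apply/existsP; exists (f x).2.
  by have /implyP-> := rF (f x); rewrite ?xf // E yf.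
rewrite -(card_in_imset fi); apply/subset_leq_card/subsetP => _ /imsetP[x xA ->].
by case: (fP _ xA).
Qed.

Lemma iso_num_le_br_num : iso_num X <= br_num X.
Proof.
rewrite /br_num; case: ex_minnP => k /existsP[F /andP[cF /eqP <-]] _.
by apply/bigmax_leqP => A iA; apply: isolated_card.
Qed.

Lemma br_num_le F : rect_cover X F -> br_num X <= #|F|.
Proof.
move=> cF; rewrite /br_num; case: ex_minnP => k _; apply.
by apply/existsP; exists F; rewrite cF eqxx.
Qed.

(** The product of the two projections of a colour class is a rectangle: a row and a column taken
    from two cells of the class meet in a one, because the cells are adjacent. *)
Lemma good_firm : good rect_adj (mem (supp X)) -> iso_num X = br_num X.
Proof.
case=> A [col [uA AX iA [c1 c2]]]; apply/eqP; rewrite eqn_leq iso_num_le_br_num /=.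
apply: (@leq_trans (size A)).
  pose rect i := ([set x.1 | x in supp X & col x == i], [set x.2 | x in supp X & col x == i]).
  have rectX i x : x \in setX (rect i).1 (rect i).2 -> x \in supp X.
    rewrite !inE => /andP[/imsetP[y + ->] /imsetP[z + ->]]; rewrite !inE.
    move=> /andP[Xy /eqP Ey] /andP[Xz /eqP Ez].
    by have /andP[] : rect_adj y z by apply: c2; rewrite /= ?inE // Ey Ez.
  pose F := [set rect (i : 'I_(size A)) | i : 'I_(size A)].
  apply: (@leq_trans #|F|); last first.
    by rewrite -[X in _ <= X](card_ord (size A)) leq_imset_card.
  apply/br_num_le/andP; split.
    apply/forallP => p; apply/implyP => /imsetP[i _ ->].
    by apply/subsetP => x /rectX.
  apply/eqP/setP => x; apply/idP/bigcupP; last by case=> _ /imsetP[i _ ->] /rectX.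
  move=> Xx; exists (rect (col x)); first by apply/imsetP; exists (Ordinal (c1 x Xx)).
  by rewrite inE; apply/andP; split; apply/imsetP; exists x; rewrite // !inE -mem_supp Xx eqxx.
rewrite -(card_uniqP uA) -cardsE; apply: (@leq_bigmax_cond _ (isolated X) (fun B : {set _} => #|B|) [set x in A]).
apply/andP; split; first by apply/subsetP => x; rewrite inE => /AX.
apply/forallP => x; apply/implyP; rewrite inE => xA.
apply/forallP => y; apply/implyP; rewrite inE => yA; apply/implyP => xy.
by rewrite common_rectP ?AX ?iA //; apply: AX.
Qed.

Lemma gap_nonfirm : gap rect_adj (mem (supp X)) -> iso_num X < br_num X.
Proof.
case=> k [ak ck]; apply: (@leq_ltn_trans k).
  apply/bigmax_leqP => A /andP[/subsetP AX /forallP iA].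
  rewrite cardE; apply: ak; first exact: enum_uniq.
    by move=> x; rewrite mem_enum => /AX.
  move=> x y; rewrite !mem_enum => xA yA xy.
  have := iA x; rewrite xA => /forallP/(_ y); rewrite yA xy /=.
  by rewrite common_rectP // AX.
rewrite ltnNge; apply/negP; rewrite /br_num.
case: ex_minnP => b /existsP[F /andP[/andP[/forallP rF /eqP cF] /eqP sF]] _ bk.
(* The colour of a cell is the position of the first rectangle of the cover that contains it. *)
pose col x := find (fun p => x \in setX p.1 p.2) (enum F).
have hasF x : x \in supp X -> has (fun p => x \in setX p.1 p.2) (enum F).
  rewrite cF => /bigcupP[p pF xp]; apply/hasP; exists p => //; by rewrite mem_enum.
apply: (ck col); split=> [x Xx|x y Xx Xy E].
  by apply: leq_trans bk; rewrite -sF cardE -has_find; apply: hasF.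
have p0 : {set 'I_m} * {set 'I_n} := (set0, set0).
have := nth_find p0 (hasF _ Xx); have := nth_find p0 (hasF _ Xy).
rewrite -/(col x) -/(col y) E; set p := nth _ _ _ => /= yp xp.
have pF : p \in F by rewrite -mem_enum mem_nth // -has_find; apply: hasF.
rewrite -common_rectP //; apply/existsP; exists p.1; apply/existsP; exists p.2.
by have /implyP-> := rF p; rewrite ?xp.
Qed.

End Bridge.

Implicit Types (g f : nat -> nat -> bool) (R C : pred nat) (E : pred (nat * nat)).

Definition meet g : rel (nat * nat) := fun x y => g x.1 y.2 && g y.1 x.2.

(** The cells of [E] leave the vertex set only. Adjacency is [meet g], which reads [g] itself, so
    they still serve as corners of rectangles. *)
Definition sub g R C E : pred (nat * nat) :=
  fun x => [&& R x.1, C x.2, g x.1 x.2 & ~~ E x].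

Definition range m : pred nat := fun i => 0 < i <= m.

Lemma meetC g : symmetric (meet g).
Proof. by move=> x y; rewrite /meet andbC. Qed.

Lemma sub_meet g R C E x : sub g R C E x -> meet g x x.
Proof. by case/and4P => _ _ gx _; rewrite /meet gx. Qed.

Lemma submx_firm m n g (R : {set 'I_m}) (C : {set 'I_n}) :
  let R' := [pred i : nat | [exists a in R, i == a.+1]] in
  let C' := [pred j : nat | [exists b in C, j == b.+1]] in
  good (meet g) (sub g R' C' pred0) ->
  iso_num (submx (mxof m n g) R C) = br_num (submx (mxof m n g) R C).
Proof.
move=> R' C' G; apply: good_firm.
pose h (x : 'I_#|R| * 'I_#|C|) := ((enum_val x.1).+1, (enum_val x.2).+1).
apply: (good_transport (h := h)) G.
- move=> x; rewrite /= mem_supp /submx /mxof !mxE /sub /h /= => ->; rewrite !andbT.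
  apply/andP; split; apply/existsP; [exists (enum_val x.1)|exists (enum_val x.2)];
  by rewrite eqxx enum_valP.
- by move=> x y _ _; rewrite /rect_adj /submx /mxof !mxE.
- move=> [i j] /and4P[/= /existsP[a /andP[aR /eqP->]] /existsP[b /andP[bC /eqP->]] gab _].
  exists (enum_rank_in aR a, enum_rank_in bC b).
    by rewrite /= mem_supp /submx /mxof !mxE /= !enum_rankK_in.
  by rewrite /h /= !enum_rankK_in.
Qed.

Lemma mxof_nonfirm m n g : gap (meet g) (sub g (range m) (range n) pred0) ->
  iso_num (mxof m n g) < br_num (mxof m n g).
Proof.
case: m => [|m]; first case=> k [_ /(_ (fun=> 0))[]]; first by split=> [x /and4P[]|x y /and4P[]]; rewrite /range; case: x.1.
case: n => [|n]; first case=> k [_ /(_ (fun=> 0))[]]; first by split=> [x /and4P[_]|x y /and4P[_]]; rewrite /range; case: x.2.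
move=> G; apply: gap_nonfirm.
pose h (x : 'I_m.+1 * 'I_n.+1) := (x.1.+1, x.2.+1).
apply: (@gap_transport _ _ _ _ _ _ h _ _ (fun y => (inord y.1.-1, inord y.2.-1))) G.
- by move=> x; rewrite /= mem_supp /mxof mxE /sub /range /= !ltnS !andbT => ->; rewrite !leq_ord.
- by move=> x y _ _; rewrite /rect_adj /submx /mxof !mxE.
- by move=> x; rewrite /= mem_supp /rect_adj => ->.
- move=> [[|i] [|j]] /and4P[] //=; rewrite /range /= !ltnS => im jn gij _.
  by rewrite /= mem_supp /submx /mxof !mxE /h /= !inordK.
Qed.

(** * Stretching *)

Definition del (a : nat) R : pred nat := fun i => R i && (i != a).
Definition add (p : nat * nat) E : pred (nat * nat) := fun x => (x == p) || E x.

Lemma good_sub_ext g R C E R' C' E' :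
  R =1 R' -> C =1 C' -> (forall x, R x.1 -> C x.2 -> g x.1 x.2 -> E x = E' x) ->
  good (meet g) (sub g R C E) -> good (meet g) (sub g R' C' E').
Proof.
move=> RR CC EE; apply: good_ext => x; rewrite /sub -RR -CC.
by case Rx: (R x.1); case Cx: (C x.2); case gx: (g x.1 x.2); rewrite //= EE.
Qed.

Lemma good_agree g g' R C E :
  (forall i j, R i -> C j -> g i j = g' i j) ->
  good (meet g) (sub g R C E) -> good (meet g') (sub g' R C E).
Proof.
move=> gg.
have EU : sub g R C E =1 sub g' R C E.
  move=> x; rewrite /sub; case Rx: (R x.1); case Cx: (C x.2) => //=.
  by rewrite gg.
apply: (good_transport (h := id)) => [x|x y|x]; first by rewrite EU.
  move=> /and4P[Rx Cx _ _] /and4P[Ry Cy _ _].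
  by rewrite /meet !gg.
by rewrite EU => Ux; exists x.
Qed.

Lemma gap_agree g g' R C E :
  (forall i j, R i -> C j -> g i j = g' i j) ->
  gap (meet g) (sub g R C E) -> gap (meet g') (sub g' R C E).
Proof.
move=> gg.
have EU : sub g R C E =1 sub g' R C E.
  move=> x; rewrite /sub; case Rx: (R x.1); case Cx: (C x.2) => //=.
  by rewrite gg.
apply: (@gap_transport _ _ _ _ _ _ id _ _ id) => [x|x y|x|x]; first by rewrite EU.
- move=> /and4P[Rx Cx _ _] /and4P[Ry Cy _ _].
  by rewrite /meet !gg.
- exact: sub_meet.
- by rewrite EU.
Qed.

(** Row [a] has its only one in column [k], so the neighbours of [(a, k)] are exactly the cells of
    that column, which form a clique. *)
Lemma good_leaf_row g R C E a k :
  R a -> C k -> g a k -> ~~ E (a, k) -> (forall y, C y -> g a y -> y = k) ->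
  good (meet g) (sub g (del a R) (del k C) E) -> good (meet g) (sub g R C E).
Proof.
move=> Ra Ck gak nE row; apply: (good_simplicial (e := (a, k)) (@meetC g)).
- by rewrite /sub /= Ra Ck gak.
- by rewrite /meet /= gak.
- move=> [i j] [i' j'] /and4P[/= Ri Cj gij _] /and4P[/= Ri' Cj' gij' _].
  rewrite /meet /= => /andP[/(row _ Cj) -> gik] /andP[/(row _ Cj') -> gik'].
  by rewrite gik gik'.
- move=> [i j]; rewrite /sub /del /meet /=.
  case Ri: (R i); case Cj: (C j); case gij: (g i j); rewrite ?andbF //=.
  case: (eqVneq j k) => [Ejk|jk] /=.
    by move: gij; rewrite Ejk => ->; rewrite gak !andbF.
  have -> : g a j = false by apply/negP => /(row _ Cj) E'; rewrite E' eqxx in jk.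
  case: (eqVneq i a) => [ia|_]; last by rewrite andbT.
  by move: gij; rewrite ia => /(row _ Cj) E'; rewrite E' eqxx in jk.
Qed.

Lemma good_leaf_col g R C E b l :
  R l -> C b -> g l b -> ~~ E (l, b) -> (forall x, R x -> g x b -> x = l) ->
  good (meet g) (sub g (del l R) (del b C) E) -> good (meet g) (sub g R C E).
Proof.
move=> Rl Cb glb nE col; apply: (good_simplicial (e := (l, b)) (@meetC g)).
- by rewrite /sub /= Rl Cb glb.
- by rewrite /meet /= glb.
- move=> [i j] [i' j'] /and4P[/= Ri Cj gij _] /and4P[/= Ri' Cj' gij' _].
  rewrite /meet /= => /andP[glj /(col _ Ri) ->] /andP[glj' /(col _ Ri') ->].
  by rewrite glj glj'.
- move=> [i j]; rewrite /sub /del /meet /=.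
  case Ri: (R i); case Cj: (C j); case gij: (g i j); rewrite ?andbF //=.
  case: (eqVneq i l) => [Eil|il] /=.
    by move: gij; rewrite Eil => ->; rewrite glb andbF.
  have -> : g i b = false by apply/negP => /(col _ Ri) E'; rewrite E' eqxx in il.
  rewrite andbF andbT; case: (eqVneq j b) => [jb|_] //.
  by move: gij; rewrite jb => /(col _ Ri) E'; rewrite E' eqxx in il.
Qed.

Section Square.
Variables (g : nat -> nat -> bool) (R C : pred nat) (E : pred (nat * nat)) (a b l k : nat).
Hypotheses (row : forall y, C y -> g a y -> y = k \/ y = b).
Hypotheses (col : forall x, R x -> g x b -> x = l \/ x = a).
Hypotheses (gab : g a b) (gak : g a k) (glb : g l b) (glk : g l k).

Hypothesis (Eab : forall x, E x -> x.1 != a /\ x.2 != b).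
Hypotheses (Ra : R a) (Cb : C b).

Let Uab : sub g R C E (a, b).
Proof. by rewrite /sub /= Ra Cb gab; apply/negP => /Eab[]; rewrite eqxx. Qed.

Let ab_refl : meet g (a, b) (a, b). Proof. by rewrite /meet /= gab. Qed.

Let ab_simp x y : sub g R C E x -> sub g R C E y ->
  meet g (a, b) x -> meet g (a, b) y -> meet g x y.
Proof.
case: x y => [i j] [i' j'] /and4P[/= Ri Cj _ _] /and4P[/= Ri' Cj' _ _].
rewrite /meet /= => /andP[/(row Cj) jE /(col Ri) iE] /andP[/(row Cj') jE' /(col Ri') iE'].
by case: jE => ->; case: iE => ->; case: jE' => ->; case: iE' => ->; apply/andP.
Qed.

Let ab_del x : sub g (del a R) (del b C) (add (l, k) E) x =
  sub g R C E x && ~~ meet g (a, b) x.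
Proof.
case: x => i j; rewrite /sub /meet /del /add /= xpair_eqE.
case Ri: (R i) => //=; case Cj: (C j); rewrite ?andbF //=.
case gij: (g i j); rewrite ?andbF //=.
case: (boolP (E (i, j))) => [/Eab[/= -> ->]|_]; rewrite ?orbT ?orbF /= ?andbF //.
case: (eqVneq i a) => [Ei|ia] /=.
  by move: gij; rewrite Ei => ->; rewrite gab.
case: (eqVneq j b) => [Ej|jb] /=.
  by move: gij; rewrite Ej => ->; rewrite gab.
congr (~~ _); apply/andP/andP => [[/eqP-> /eqP->] //|[]].
move=> /(row Cj)[->|E2]; last by rewrite E2 eqxx in jb.
move=> /(col Ri)[->|E2]; last by rewrite E2 eqxx in ia.
by rewrite !eqxx.
Qed.

(** The neighbours of [(a, b)] lie in the all-one square on rows [a], [l] and columns [b], [k], so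
    [(a, b)] is simplicial. Its elimination clears row [a] and column [b] and turns [(l, k)] into a
    marked cell. *)
Lemma good_square : good (meet g) (sub g (del a R) (del b C) (add (l, k) E)) ->
  good (meet g) (sub g R C E).
Proof. exact: (good_simplicial (@meetC g) Uab ab_refl ab_simp ab_del). Qed.

Lemma gap_square : gap (meet g) (sub g (del a R) (del b C) (add (l, k) E)) ->
  gap (meet g) (sub g R C E).
Proof. exact: (gap_simplicial Uab ab_refl ab_simp ab_del). Qed.

End Square.

(* What a copy of [C_t], [t >= 3], leaves on the rows [Ru] and columns [Cu] it uses. *)
Definition cyclic g (Ru Cu : nat -> Prop) :=
  [/\ forall a, Ru a -> exists b b', [/\ b <> b', Cu b, Cu b' & g a b && g a b'],
      forall b, Cu b -> exists a a', [/\ a <> a', Ru a, Ru a' & g a b && g a' b],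
      forall a a' b b', Ru a -> Ru a' -> Cu b -> Cu b' -> a <> a' -> b <> b' ->
        ~~ [&& g a b, g a b', g a' b & g a' b']
    & exists a b c, [/\ Ru a, Ru b & Ru c] /\ [/\ a <> b, a <> c & b <> c]].

Lemma cyclic_agree g g' (Ru Cu : nat -> Prop) :
  (forall i j, Ru i -> Cu j -> g i j = g' i j) -> cyclic g Ru Cu -> cyclic g' Ru Cu.
Proof.
move=> gg [H1 H2 H3 H4]; split=> //.
- move=> a Ra; have [b [b' [bb Cb Cb' gab]]] := H1 a Ra.
  by exists b, b'; split=> //; rewrite -!gg.
- move=> b Cb; have [a [a' [aa Ra Ra' gab]]] := H2 b Cb.
  by exists a, a'; split=> //; rewrite -!gg.
- by move=> a a' b b' Ra Ra' Cb Cb' aa bb; rewrite -!gg //; apply: H3.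
Qed.

(** A used row [a] must have its two ones at [k] and [b], and a used column [b] at [l] and [a].
    Either one forces the other, and together with the one at [(l, k)] they give an all-one 2 by 2
    square. *)
Lemma cyclic_corner g (Ru Cu : nat -> Prop) a b l k : cyclic g Ru Cu ->
  (forall y, Cu y -> g a y -> y = k \/ y = b) ->
  (forall x, Ru x -> g x b -> x = l \/ x = a) -> g l k -> ~ Ru a /\ ~ Cu b.
Proof.
move=> [H1 H2 H3 _] row col glk.
have rowP : Ru a -> [/\ Cu k, Cu b, k <> b, g a k & g a b].
  move=> Ra; have [y [y' [yy Cy Cy' /andP[gy gy']]]] := H1 a Ra.
  by case: (row _ Cy gy) (row _ Cy' gy') => Ey [] Ey'; subst => //; split=> //; apply: nesym.
have colP : Cu b -> [/\ Ru l, Ru a, l <> a & g l b].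
  move=> Cb; have [x [x' [xx Rx Rx' /andP[gx gx']]]] := H2 b Cb.
  by case: (col _ Rx gx) (col _ Rx' gx') => Ex [] Ex'; subst => //; split=> //; apply: nesym.
have nCb : ~ Cu b.
  move=> Cb; have [Rl Ra la glb] := colP Cb; have [Ck _ kb gak gab] := rowP Ra.
  by have := H3 l a k b Rl Ra Ck Cb la kb; rewrite glk glb gak gab.
by split=> // /rowP[_ /nCb].
Qed.

Lemma not_cyclic_totally_balanced m n g :
  (forall Ru Cu : nat -> Prop, (forall i, Ru i -> range m i) ->
     (forall j, Cu j -> range n j) -> ~ cyclic g Ru Cu) ->
  totally_balanced (mxof m n g).
Proof.
move=> nc [t [f [h [t3 fi hi E]]]].
pose Ru a := exists i : 'I_t, a = (f i).+1; pose Cu b := exists j : 'I_t, b = (h j).+1.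
have {}E i j : g (f i).+1 (h j).+1 = Cf t i.+1 j.+1 by have := E i j; rewrite /Cmx /mxof !mxE.
have neqf (i i' : 'I_t) : i != i' :> nat -> (f i).+1 <> (f i').+1.
  by move=> ii [/ord_inj/fi Ei]; rewrite Ei eqxx in ii.
have neqh (j j' : 'I_t) : j != j' :> nat -> (h j).+1 <> (h j').+1.
  by move=> jj [/ord_inj/hi Ej]; rewrite Ej eqxx in jj.
apply: (nc Ru Cu); [by move=> _ [i ->]; exact: ltn_ord|by move=> _ [j ->]; exact: ltn_ord|split].
- move=> _ [i ->].
  (* Row [i] of [C_t] has its ones in column [i] and the cyclically next one; column [j], below, in
     row [j] and the cyclically previous one. *)
  have lt : (if i.+1 < t then i.+1 else 0) < t by case: ifP => // _; lia.
  exists (h i).+1, (h (Ordinal lt)).+1; split; first 1 last.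
  + by exists i.
  + by exists (Ordinal lt).
  + by rewrite !E /Cf /=; have := ltn_ord i; case: ifP; lia.
  + by apply: neqh => /=; case: ifP; lia.
- move=> _ [j ->].
  have lt : (if 0 < j then j.-1 else t.-1) < t by have := ltn_ord j; case: ifP; lia.
  exists (f j).+1, (f (Ordinal lt)).+1; split; first 1 last.
  + by exists j.
  + by exists (Ordinal lt).
  + by rewrite !E /Cf /=; have := ltn_ord j; case: ifP; lia.
  + by apply: neqf => /=; case: ifP; lia.
- move=> _ _ _ _ [i ->] [i' ->] [j ->] [j' ->] ii jj; rewrite !E.
  have {}ii : i != i' :> nat by apply/eqP => /ord_inj Ei; apply: ii; rewrite Ei.
  have {}jj : j != j' :> nat by apply/eqP => /ord_inj Ej; apply: jj; rewrite Ej.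
  move: ii jj (ltn_ord i) (ltn_ord i') (ltn_ord j) (ltn_ord j') t3; rewrite /Cf.
  move: (i : nat) (i' : nat) (j : nat) (j' : nat); clear; lia.
- have l0 : 0 < t by lia.
  have l1 : 1 < t by lia.
  exists (f (Ordinal l0)).+1, (f (Ordinal l1)).+1, (f (Ordinal t3)).+1.
  by split; split; try (by apply: neqf); eexists.
Qed.

Definition full m R := forall i, range m i -> R i.

Section Stretch.
Variables (m n : nat) (Q : seq (nat * nat)) (f : nat -> nat -> bool).
Hypothesis QX : forall x, x \in Q -> [/\ range m x.1, range n x.2 & f x.1 x.2].
Hypothesis uQ : uniq Q.

Let s := stretchf m n Q f.
Let Qn t := nth (0, 0) Q t.

Let s_base i j : i <= m -> j <= n -> s i j = f i j.
Proof. by rewrite /s /stretchf => -> ->. Qed.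

Let s_col i t : i <= m -> t < size Q -> s i (n + t.+1) = ((Qn t).1 == i).
Proof.
move=> im tq; rewrite /s /stretchf im (_ : (n + t.+1 <= n) = false); last by lia.
by rewrite addKn /= tq.
Qed.

Let s_row t j : t < size Q -> j <= n -> s (m + t.+1) j = ((Qn t).2 == j).
Proof.
move=> tq jn; rewrite /s /stretchf (_ : (m + t.+1 <= m) = false); last by lia.
by rewrite addKn /= tq jn.
Qed.

Let s_corner t u : t < size Q -> s (m + t.+1) (n + u.+1) = (u == t).
Proof.
move=> tq; rewrite /s /stretchf (_ : (m + t.+1 <= m) = false); last by lia.
rewrite (_ : (n + u.+1 <= n) = false); last by lia.
by rewrite !addKn /= tq eqSS.
Qed.

Section Peel.
Variables (t : nat) (R C : pred nat) (E : pred (nat * nat)).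
Hypothesis tq : t < size Q.
Hypotheses (Rm : forall i, R i -> range (m + t.+1) i).
Hypotheses (Cn : forall j, C j -> range (n + t.+1) j).
Hypothesis (EQ : forall x, E x -> x \in Q).
Let l := (Qn t).1.
Let k := (Qn t).2.
Let a := m + t.+1.
Let b := n + t.+1.

Let lk : [/\ range m l, range n k & f l k].
Proof. by apply: QX; rewrite mem_nth. Qed.

Lemma peel_cells_row y : y <= n + size Q -> s a y -> y = k \/ y = b.
Proof.
move=> yq say; case: (leqP y n) => yn; first by move: say; rewrite s_row // => /eqP; left.
have Ey : y = n + (y - n).-1.+1 by lia.
by move: say; rewrite {1}Ey s_corner // /b => /eqP E'; right; lia.
Qed.

Lemma peel_cells_col x : x <= m + size Q -> s x b -> x = l \/ x = a.
Proof.
move=> xq sxb; case: (leqP x m) => xm; first by move: sxb; rewrite s_col // => /eqP; left.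
have Ex : x = m + (x - m).-1.+1 by lia.
have xq' : (x - m).-1 < size Q by move: xm xq; lia.
by move: sxb; rewrite {1}Ex s_corner // /a => /eqP E'; right; lia.
Qed.

Lemma peel_row y : C y -> s a y -> y = k \/ y = b.
Proof.
by move=> /Cn /andP[_ yb]; apply: peel_cells_row; apply: leq_trans yb _; rewrite leq_add2l.
Qed.

Lemma peel_col x : R x -> s x b -> x = l \/ x = a.
Proof.
by move=> /Rm /andP[_ xa]; apply: peel_cells_col; apply: leq_trans xa _; rewrite leq_add2l.
Qed.

Lemma peel_cells : [/\ s a b, s a k, s l b & s l k].
Proof.
have [/andP[_ lm] /andP[_ kn] flk] := lk.
by rewrite s_corner // s_row // s_col // s_base // !eqxx.
Qed.

Lemma peel_E x : E x -> x.1 != a /\ x.2 != b.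
Proof. move=> /EQ/QX[/andP[_ x1] /andP[_ x2] _].
by split; apply/eqP => E'; [move: x1|move: x2]; rewrite E' /a /b; lia.
Qed.

Lemma peel_gap : R a -> C b ->
  gap (meet s) (sub s (del a R) (del b C) (add (l, k) E)) -> gap (meet s) (sub s R C E).
Proof.
have [c1 c2 c3 c4] := peel_cells;
by move=> Ra Cb; apply: (gap_square peel_row peel_col c1 c2 c3 c4 peel_E Ra Cb).
Qed.

(** If both corner lines are kept, the corner is eliminated as a square and marks [(l, k)]. If one
    is missing, the other holds at most one cell, which is eliminated as a leaf together with a line
    of the base. Something is missing in that case already, so the second premise allows any further
    lines to go. *)
Lemma peel_good :
  (R a -> C b -> good (meet s) (sub s (del a R) (del b C) (add (l, k) E))) ->
  (~~ (R a && C b) -> forall R1 C1, (forall i, R1 i -> R i && (i != a)) ->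
     (forall j, C1 j -> C j && (j != b)) -> good (meet s) (sub s R1 C1 E)) ->
  good (meet s) (sub s R C E).
Proof.
have [c1 c2 c3 c4] := peel_cells;
case: (boolP (R a)) => Ra; case: (boolP (C b)) => Cb /= H1 H2.
- by apply: (good_square peel_row peel_col c1 c2 c3 c4 peel_E Ra Cb); apply: H1.
- case: (boolP (C k)) => Ck.
    apply: (@good_leaf_row _ _ _ _ a k) => //.
    + by apply/negP => /peel_E[]; rewrite eqxx.
    + by move=> y Cy /(peel_row Cy)[//|E']; rewrite -E' Cy in Cb.
    + apply: H2 => // j; rewrite /del => /andP[Cj _]; rewrite Cj /=.
      by apply: contraNneq Cb => <-.
  (* Here column [k] is missing as well as [b], so row [a] carries no cell at all. *)
  apply: good_ext (H2 isT (del a R) C _ _) => //.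
    move=> [i j]; rewrite /sub /del /=; case: (R i) => //=; case Cj: (C j); rewrite ?andbF //=.
    case: (eqVneq i a) => [->|//]; case saj: (s a j) => //.
    by case: (peel_row Cj saj) => E'; [move: Ck|move: Cb]; rewrite -E' Cj.
  by move=> j Cj; rewrite Cj; apply: contraNneq Cb => <-.
- case: (boolP (R l)) => Rl.
    apply: (@good_leaf_col _ _ _ _ b l) => //.
    + by apply/negP => /peel_E[_]; rewrite eqxx.
    + by move=> y Ry /(peel_col Ry)[//|E']; rewrite -E' Ry in Ra.
    + apply: H2 => // i; rewrite /del => /andP[Ri _]; rewrite Ri /=.
      by apply: contraNneq Ra => <-.
  apply: good_ext (H2 isT R (del b C) _ _) => //.
    move=> [i j]; rewrite /sub /del /=; case Ri: (R i) => //=; case Cj: (C j) => //=.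
    case: (eqVneq j b) => [->|//]; case saj: (s i b) => //.
    by case: (peel_col Ri saj) => E'; [move: Rl|move: Ra]; rewrite -E' Ri.
  by move=> i Ri; rewrite Ri; apply: contraNneq Ra => <-.
- apply: H2 => // i Hi; rewrite Hi; first by apply: contraNneq Ra => <-.
  by apply: contraNneq Cb => <-.
Qed.

End Peel.

Lemma stretch_not_cyclic :
  (forall Ru Cu : nat -> Prop, (forall i, Ru i -> range m i) ->
     (forall j, Cu j -> range n j) -> ~ cyclic f Ru Cu) ->
  totally_balanced (stretch m n Q f).
Proof.
move=> nc; apply: not_cyclic_totally_balanced => Ru Cu Rm Cn cyc.
have out t : t < size Q -> ~ Ru (m + t.+1) /\ ~ Cu (n + t.+1).
  move=> tq; have [/andP[_ lm] /andP[_ kn] flk] : _ := QX (mem_nth (0, 0) tq).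
  apply: (cyclic_corner cyc (l := (Qn t).1) (k := (Qn t).2)).
  - by move=> y /Cn/andP[_ yq]; apply: peel_cells_row.
  - by move=> y /Rm/andP[_ yq]; apply: peel_cells_col.
  - by rewrite -/s s_base.
have Rm' i : Ru i -> range m i.
  move=> Ri; have /andP[i0 iq] := Rm i Ri; rewrite /range i0 leqNgt; apply/negP => im.
  have [] := out (i - m).-1 ltac:(lia); rewrite (_ : m + (i - m).-1.+1 = i) //; lia.
have Cn' j : Cu j -> range n j.
  move=> Cj; have /andP[j0 jq] := Cn j Cj; rewrite /range j0 leqNgt; apply/negP => jn.
  have [_] := out (j - n).-1 ltac:(lia); rewrite (_ : n + (j - n).-1.+1 = j) //; lia.
apply: (nc Ru Cu Rm' Cn'); apply: cyclic_agree cyc => i j /Rm'/andP[_ im] /Cn'/andP[_ jn].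
by rewrite -/s s_base.
Qed.

Lemma stretch_gap :
  gap (meet f) (sub f (range m) (range n) (mem Q)) ->
  gap (meet s) (sub s (range (m + size Q)) (range (n + size Q)) pred0).
Proof.
move=> G.
have H t : t <= size Q ->
    gap (meet s) (sub s (range (m + t)) (range (n + t)) (mem (drop t Q))).
  elim: t => [|t IH] tq.
    rewrite !addn0 drop0; apply: gap_agree G => i j /andP[_ im] /andP[_ jn].
    by rewrite s_base.
  apply: (peel_gap tq) => //; try by rewrite /range; lia.
    by move=> x /mem_drop.
  apply: gap_ext (IH (ltnW tq)) => x.
  have dE a p i : del (a + p.+1) (range (a + p.+1)) i = range (a + p) i.
    by rewrite /del /range; lia.
  by rewrite /sub !dE (drop_nth (0, 0) tq) /add /= inE -surjective_pairing.
by apply: gap_ext (H _ (leqnn _)) => x; rewrite drop_size.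
Qed.

(** After [size Q - t] corners have been peeled, the marked cells lie in [drop t Q]. They are all of
    it, on full lines, only if no line was missing at the start. *)
Lemma stretch_good :
  (forall R C E, (forall i, R i -> range m i) -> (forall j, C j -> range n j) ->
     (forall x, E x -> x \in Q) ->
     ~ [/\ full m R, full n C & forall x, x \in Q -> E x] ->
     good (meet f) (sub f R C E)) ->
  forall R C, (forall i, R i -> range (m + size Q) i) ->
    (forall j, C j -> range (n + size Q) j) ->
    ~ (full (m + size Q) R /\ full (n + size Q) C) ->
    good (meet s) (sub s R C pred0).
Proof.
move=> G0.
have H t : t <= size Q -> forall R C E, (forall i, R i -> range (m + t) i) ->
    (forall j, C j -> range (n + t) j) -> (forall x, E x -> x \in drop t Q) ->
    ~ [/\ full (m + t) R, full (n + t) C & forall x, x \in drop t Q -> E x] ->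
    good (meet s) (sub s R C E).
  elim: t => [|t IH] tq R C E.
    rewrite !addn0 drop0 => Rm Cn EQ nf.
    apply: good_agree (G0 R C E Rm Cn EQ nf) => i j /Rm/andP[_ im] /Cn/andP[_ jn].
    by rewrite s_base.
  move=> Rm Cn EQ nf.
  have EQ' x : E x -> x \in Q by move/EQ/mem_drop.
  have dQ x : x \in drop t Q = (x == Qn t) || (x \in drop t.+1 Q).
    by rewrite (drop_nth (0, 0) tq) inE.
  (* [Q] has no repetition, so [Qn t] can be marked only by its own corner. If a line of that corner
     is missing, [Qn t] stays unmarked and the forbidden configuration is out of reach. *)
  have nE : ~~ E (Qn t).
    apply/negP => /EQ; have : uniq (drop t Q) by rewrite drop_uniq.
    by rewrite (drop_nth (0, 0) tq) /= => /andP[/negPf->].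
  have dr (M : nat) (P : pred nat) : (forall i, P i -> range (M + t.+1) i) ->
      forall i, P i && (i != M + t.+1) -> range (M + t) i.
    by move=> PM i /andP[/PM]; rewrite /range; lia.
  apply: (peel_good tq Rm Cn EQ') => [Ra Cb|nab R1 C1 R1R C1C]; apply: IH.
  - exact: ltnW.
  - by move=> i; apply: dr.
  - by move=> i; apply: dr.
  - by move=> x; rewrite dQ /add -surjective_pairing => /orP[->//|/EQ->]; rewrite orbT.
  - move=> [fR fC fE]; apply: nf; split.
    + move=> i ir; case: (eqVneq i (m + t.+1)) => [-> //|im].
      have /fR/andP[] // : range (m + t) i by move: ir; rewrite /range; lia.
    + move=> i ir; case: (eqVneq i (n + t.+1)) => [-> //|im].
      have /fC/andP[] // : range (n + t) i by move: ir; rewrite /range; lia.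
    + move=> x xd; have : add ((Qn t).1, (Qn t).2) E x by apply: fE; rewrite dQ xd orbT.
      rewrite /add -surjective_pairing => /orP[/eqP Ex|//].
      have : uniq (drop t Q) by rewrite drop_uniq.
      by rewrite (drop_nth (0, 0) tq) /= -/(Qn t) -Ex xd.
  - exact: ltnW.
  - by move=> i /R1R; apply: dr.
  - by move=> i /C1C; apply: dr.
  - by move=> x /EQ xd; rewrite dQ xd orbT.
  - move=> [_ _ fE]; case/negP: nE; apply: fE; by rewrite dQ eqxx.
move=> R C Rm Cn nf; apply: (H (size Q)) => // [[fR fC _]]; exact: nf.
Qed.

Lemma stretch_minimally_non_firm :
  gap (meet f) (sub f (range m) (range n) (mem Q)) ->
  (forall R C E, (forall i, R i -> range m i) -> (forall j, C j -> range n j) ->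
     (forall x, E x -> x \in Q) ->
     ~ [/\ full m R, full n C & forall x, x \in Q -> E x] ->
     good (meet f) (sub f R C E)) ->
  minimally_non_firm (stretch m n Q f).
Proof.
move=> Hgap Hgood; split; first exact/mxof_nonfirm/stretch_gap.
move=> R C nf; apply: submx_firm; apply: stretch_good => //.
- by move=> i /existsP[a /andP[_ /eqP->]]; rewrite /range /= ltn_ord.
- by move=> i /existsP[a /andP[_ /eqP->]]; rewrite /range /= ltn_ord.
move=> [fR fC]; case/orP: nf => /eqP; apply; apply/setP => a; rewrite inE.
  by have /existsP[b /andP[bR /eqP[/ord_inj->]]] : _ := fR a.+1 (ltn_ord a).
by have /existsP[b /andP[bR /eqP[/ord_inj->]]] : _ := fC a.+1 (ltn_ord a).
Qed.

End Stretch.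

(** * Computation on bounded matrices, and fans *)

Section Check.
Variables (g : nat -> nat -> bool).
Variable certs : seq (seq (nat * nat) * seq (seq (nat * nat))).
Implicit Types (U A : seq (nat * nat)).

Definition simplicial U e :=
  let N := [seq x <- U | meet g e x] in all (fun x => all (meet g x) N) N.

(* [c] is an isolated set together with as many cliques, for the few cell sets
   that have no simplicial cell. *)
Definition certifies U (c : seq (nat * nat) * seq (seq (nat * nat))) :=
  [&& uniq c.1, all (mem U) c.1,
      all (fun x => all (fun y => (x != y) ==> ~~ meet g x y) c.1) c.1,
      size c.2 == size c.1,
      all (fun K : seq (nat * nat) =>
             let K' := [seq x <- K | x \in U] in all (fun x => all (meet g x) K') K') c.2 &
      all (fun x => has (fun K : seq (nat * nat) => x \in K) c.2) U].

(** Greedy simplicial elimination. Each round removes at least the cell chosen, so the number of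
    cells is enough fuel; a stuck set must match a certificate. *)
Fixpoint check fuel U :=
  if U is [::] then true else
  if fuel is fuel'.+1 then
    if [seq e <- U | simplicial U e] is e :: _
    then check fuel' [seq x <- U | ~~ meet g e x]
    else has (certifies U) certs
  else false.

Lemma check_good fuel U : all (fun x => g x.1 x.2) U -> check fuel U ->
  good (meet g) (mem U).
Proof.
elim: fuel U => [|fuel IH] [|u U] // gU.
1,2: by move=> _; exists [::], (fun=> 0).
rewrite /check -/check; set V := u :: U in gU *.
case E: [seq e <- V | simplicial V e] => [|e S].
  case/hasP => -[A Ks] _ /and5P[uA /allP AV /allP iA /eqP sA /andP[/allP clK /allP cov]].
  exists A, (fun x => find (fun K : seq (nat * nat) => x \in K) Ks); split=> //.
    by move=> x y xA yA; have /allP/(_ y yA)/implyP := iA x xA.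
  split=> [x /cov|x y xV yV]; first by rewrite has_find sA.
  have := nth_find [::] (cov _ xV); have := nth_find [::] (cov _ yV).
  move=> yK xK Ek; rewrite Ek in xK.
  have := mem_nth [::] (_ : find (fun K : seq (nat * nat) => y \in K) Ks < size Ks).
  rewrite -has_find => /(_ (cov _ yV)) /clK /allP /(_ x); rewrite mem_filter xK (xV : x \in V).
  by move/(_ isT)/allP/(_ y); rewrite mem_filter yK (yV : y \in V); apply.
have : e \in [seq e <- V | simplicial V e] by rewrite E mem_head.
rewrite mem_filter => /andP[/allP simp eV] /IH G.
apply: (good_simplicial (e := e) (@meetC g)) (G _).
- exact: eV.
- by have /= ge := allP gU _ eV; rewrite /meet ge.
- move=> x y xV yV ex ey; have xN : x \in [seq z <- V | meet g e z] by rewrite mem_filter ex.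
  have /allP : all (meet g x) [seq z <- V | meet g e z] := simp x xN.
  by apply; rewrite mem_filter ey (yV : y \in V).
- by move=> x; rewrite [LHS]mem_filter andbC.
- by apply/allP => x; rewrite mem_filter => /andP[_ xV]; apply: (allP gU).
Qed.

(** The predicate is specialised bit by bit, so the list of all masks is never built. *)
Fixpoint all_masks k (P : seq bool -> bool) :=
  if k is k'.+1 then all_masks k' (fun s => P (true :: s)) && all_masks k' (fun s => P (false :: s))
  else P [::].

Lemma all_masksP k P : all_masks k P -> forall s, size s = k -> P s.
Proof.
elim: k P => [|k IH] P /=; first by move=> P0 [].
case/andP => Pt Pf [|b s] //= [sk].
by case: b; [apply: (IH (fun s => P (true :: s)))|apply: (IH (fun s => P (false :: s)))].
Qed.

Variables (rs cs : seq nat) (Es : seq (nat * nat)).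
Variable keep : seq bool -> seq bool -> seq bool -> bool.

Let cells := [seq x <- [seq (i, j) | i <- rs, j <- cs] | g x.1 x.2].

Definition check_all :=
  all_masks (size rs) (fun mr => all_masks (size cs) (fun mc => all_masks (size Es) (fun me =>
    keep mr mc me ==> check (size cells)
      [seq x <- cells | [&& nth false mr (index x.1 rs), nth false mc (index x.2 cs)
                         & x \notin mask me Es]]))).

Lemma check_all_good : check_all -> forall R C E,
  (forall i, R i -> i \in rs) -> (forall j, C j -> j \in cs) ->
  (forall x, E x -> x \in Es) -> keep (map R rs) (map C cs) (map E Es) ->
  good (meet g) (sub g R C E).
Proof.
move=> H R C E Rrs Ccs EEs kp.
have := all_masksP (all_masksP (all_masksP H (size_map R rs)) (size_map C cs)) (size_map E Es).
rewrite kp /= => /check_good G; apply: good_ext (G _).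
  move=> [i j]; rewrite /= !mem_filter /sub /= -filter_mask mem_filter.
  have -> : ((i, j) \in [seq (i0, j0) | i0 <- rs, j0 <- cs]) = (i \in rs) && (j \in cs).
    by apply/allpairsP/andP => [[[? ?] [/= ? ? [-> ->]]]|[? ?]] //; exists (i, j).
  have nthE (P : pred nat) s k : k \in s -> nth false (map P s) (index k s) = P k.
    by move=> ks; rewrite (nth_map 0) ?index_mem // nth_index.
  have notR (P : pred nat) s k : (forall k, P k -> k \in s) -> k \notin s -> P k = false.
    by move=> Ps; apply: contraNF => /Ps.
  case: (boolP (i \in rs)) => irs; last by rewrite (notR _ _ _ _ Rrs irs) !andbF.
  case: (boolP (j \in cs)) => jcs; last by rewrite (notR _ _ _ _ Ccs jcs) !andbF.
  rewrite !nthE // !andbT.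
  have -> : E (i, j) && ((i, j) \in Es) = E (i, j).
    by case: (boolP (E (i, j))) => // /EEs ->.
  by case: (R i); case: (C j); case: (g i j); rewrite ?andbF ?andbT.
by apply/allP => x; rewrite !mem_filter => /and3P[].
Qed.

End Check.

Section Fan.
Variables (g : nat -> nat -> bool) (c : nat) (r k : nat -> nat) (L : nat).
Variables (R0 C0 : pred nat) (E : pred (nat * nat)).
Hypothesis gc : forall i, i <= L -> R0 c -> g c (k i).
Hypothesis gr : forall i, 0 < i <= L -> g (r i) (k i) && g (r i) (k i.-1).
Hypothesis gr_row : forall i y, 0 < i <= L -> C0 y -> g (r i) y -> y = k i \/ y = k i.-1.
Hypothesis gk_col : forall i x, 0 < i <= L -> R0 x -> g x (k i) ->
  [\/ x = c, x = r i | i < L /\ x = r i.+1].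
Hypothesis rc : forall i, 0 < i <= L -> r i != c.
Hypothesis kk : forall i, 0 < i <= L -> k i.-1 != k i.
Hypothesis E_tail : forall i x, 0 < i <= L -> E x -> x.1 != r i /\ x.2 != k i.

Let cut l R C := [/\ forall i, R i -> R0 i, forall j, C j -> C0 j &
  forall i, l < i <= L -> ~~ R (r i) && ~~ C (k i)].

Let two l R C := good (meet g) (sub g R C E) /\ good (meet g) (sub g R C (add (c, k l) E)).

Hypothesis base : forall R C, cut 0 R C -> two 0 R C.

(** Row [c] is the hub, the [k i] are the spokes and [r i] joins spokes [i - 1] and [i]. Once
    everything beyond [l + 1] is gone, column [k l.+1] meets only the hub and [r l.+1], so the end
    of the fan can be eliminated. This may mark the spoke cell [(c, k l)], which is why the
    induction carries the marked and the unmarked version together. *)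
Lemma fan_good l R C : l <= L -> cut l R C -> two l R C.
Proof.
elim: l R C => [|l IH] R C lL; first exact: base.
case=> RR0 CC0 RC.
have l1 : 0 < l.+1 <= L by [].
have IH' R1 C1 : (forall i, R1 i -> R i) -> (forall j, C1 j -> C j) ->
    ~~ R1 (r l.+1) -> ~~ C1 (k l.+1) -> two l R1 C1.
  move=> R1R C1C nR nC; apply: IH; first exact: ltnW.
  split=> [i /R1R/RR0 //|j /C1C/CC0 //|i /andP[li iL]].
  move: li; rewrite leq_eqVlt => /orP[/eqP<-|li]; first by rewrite nR nC.
  have /andP[nRi nCi] : ~~ R (r i) && ~~ C (k i) by apply: RC; rewrite li.
  by rewrite (contra (R1R _) nRi) (contra (C1C _) nCi).
have col x : R x -> g x (k l.+1) -> x = c \/ x = r l.+1.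
  move=> Rx gx; case: (gk_col l1 (RR0 _ Rx) gx) => [->|->|[lt Ex]]; [by left|by right|].
  by have := RC l.+2; rewrite ltnSn lt -Ex Rx => /(_ isT).
have row y : C y -> g (r l.+1) y -> y = k l.+1 \/ y = k l.
  by move=> Cy; apply: gr_row => //; apply: CC0.
have /andP[grk grk0] := gr l1.
have := rc l1; have := kk l1; rewrite /=.
have HE x : E x -> x.1 != r l.+1 /\ x.2 != k l.+1 by apply: E_tail.
have gck : R c -> g c (k l.+1) by move=> /RR0; apply: gc.
have gck0 : R c -> g c (k l) by move=> /RR0; apply: gc; apply: ltnW.
set r1 := r l.+1 in IH' col row grk grk0 HE *; set k1 := k l.+1 in IH' col row grk HE gck *.
set k0 := k l in row grk0 gck0 *; move=> kk0 rc0.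
pose F (b : bool) := if b then add (c, k1) E else E.
suff H b : good (meet g) (sub g R C (F b)) by split; [apply: (H false)|apply: (H true)].
have del_sub a P : forall i, del a P i -> P i by move=> i /andP[].
have del_out a P : ~~ del a P a by rewrite /del eqxx andbF.
have [_ IH2] := IH' (del r1 R) (del k1 C) (del_sub _ _) (del_sub _ _) (del_out _ _) (del_out _ _).
have none : (forall x, sub g R C (F b) x -> x.1 != r1 /\ x.2 != k1) ->
    good (meet g) (sub g R C (F b)).
  move=> no; have [G _] := IH' (del r1 R) (del k1 C) (del_sub _ _) (del_sub _ _) (del_out _ _) (del_out _ _).
  apply: good_ext G => x; case: (boolP (sub g R C (F b) x)) => [Ux|].
    have [n1 n2] := no x Ux; move: Ux; rewrite /sub /del n1 n2 !andbT => /and4P[-> -> -> /=].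
    by rewrite /F; case: b {no} => //; rewrite /add negb_or => /andP[].
  apply: contraNF; rewrite /sub /del /F => /and4P[/andP[-> _] /andP[-> n2] -> nE] /=.
  by case: b {no}; rewrite // /add negb_or nE andbT; apply: contra n2 => /eqP->.
case: (boolP (R r1)) => Rr; case: (boolP (C k1)) => Ck.
- apply: (good_simplicial (e := (r1, k1)) (@meetC g)) IH2.
  + rewrite /sub /= Rr Ck grk /=; apply/negP; rewrite /F.
    case: b {none} => [/orP[/eqP[E']|]|]; first by rewrite E' eqxx in rc0.
      by move=> /HE[]; rewrite eqxx.
    by move=> /HE[]; rewrite eqxx.
  + by rewrite /meet /= grk.
  + move=> [i j] [i' j'] /and4P[/= Ri Cj _ _] /and4P[/= Ri' Cj' _ _].
    rewrite /meet /= => /andP[/(row _ Cj) jE /(col _ Ri) iE] /andP[/(row _ Cj') jE' /(col _ Ri') iE'].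
    have gg a d : R a -> a = c \/ a = r1 -> d = k1 \/ d = k0 -> g a d.
      by move=> Ra [Ea|->] [->|->] //; move: Ra; rewrite Ea => Rc; rewrite ?gck ?gck0.
    by rewrite !gg.
  + move=> [i j]; apply/idP/idP.
      rewrite /sub /del /meet /= => /and4P[/andP[Ri ir] /andP[Cj jk] gij].
      rewrite /add negb_or => /andP[nck nE]; rewrite Ri Cj gij /=; apply/andP; split.
        by rewrite /F; case: b {none} => //; rewrite /add negb_or nE andbT; apply: contra jk => /eqP[_ ->].
      apply/negP => /andP[/(row _ Cj)[E1|E1]]; first by rewrite E1 eqxx in jk.
      move=> /(col _ Ri)[E2|E2]; last by rewrite E2 eqxx in ir.
      by rewrite E1 E2 eqxx in nck.
    rewrite /sub /del /meet /= => /andP[/and4P[Ri Cj gij nF] nm]; rewrite Ri Cj gij /=.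
    have -> : i != r1 by apply: contra nm => /eqP E1; rewrite -E1 gij E1 grk.
    have -> : j != k1 by apply: contra nm => /eqP E1; move: gij; rewrite E1 => ->; rewrite grk.
    rewrite /= /add negb_or; apply/andP; split.
      by apply: contra nm => /eqP[E1 ->]; rewrite grk0 E1 gck // -E1.
    by move: nF; rewrite /F; case: b {none} => //; rewrite /add negb_or => /andP[].
- case: (boolP (C k0)) => Ck0; last first.
    apply: none => -[i j] /and4P[/= Ri Cj gij _]; split; last by apply: contraNneq Ck => <-.
    by apply/eqP => E1; case: (row j Cj _) => [|E2|E2]; rewrite -?E1 //; [move: Ck|move: Ck0]; rewrite -E2 Cj.
  apply: (@good_leaf_row _ _ _ _ r1 k0) => //.
  + rewrite /F; apply/negP; case: b {none} => [/orP[/eqP[_ E']|]|]; first by rewrite E' eqxx in kk0.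
      by move=> /HE[]; rewrite eqxx.
    by move=> /HE[]; rewrite eqxx.
  + by move=> y Cy /(row _ Cy)[E1|//]; rewrite -E1 Cy in Ck.
  have nC : ~~ del k0 C k1 by apply: contra Ck => /andP[].
  have [G _] := IH' (del r1 R) (del k0 C) (del_sub _ _) (del_sub _ _) (del_out _ _) nC.
  apply: good_sub_ext G => // -[i j] _ /andP[Cj _] _ /=; rewrite /F; case: b {none} => //.
  by rewrite /add xpair_eqE; case: (eqVneq j k1) => [E1|]; rewrite ?andbF //; rewrite -E1 Cj in Ck.
- case: (boolP (R c)) => Rc; last first.
    apply: none => -[i j] /and4P[/= Ri Cj gij _]; split; first by apply: contraNneq Rr => <-.
    by apply/eqP => E1; case: (col i Ri _) => [|E2|E2]; rewrite -?E1 //; [move: Rc|move: Rr]; rewrite -E2 Ri.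
  (* Row [r1] is gone. If [(c, k1)] is marked, column [k1] holds no cell; otherwise [(c, k1)] is its
     only cell and is eliminated as a leaf. *)
  case: b none => none.
    apply: none => -[i j] /and4P[/= Ri Cj gij nF]; split; first by apply: contraNneq Rr => <-.
    apply/eqP => E1; case: (col i Ri _) => [|E2|E2]; rewrite -?E1 //; last by rewrite -E2 Ri in Rr.
    by move: nF; rewrite /F /add E1 E2 eqxx.
  apply: (@good_leaf_col _ _ _ _ k1 c) => //; first exact: gck.
  + by apply/negP => /HE[_]; rewrite eqxx.
  + by move=> x Rx /(col _ Rx)[//|E1]; rewrite -E1 Rx in Rr.
  have nR : ~~ del c R r1 by apply: contra Rr => /andP[].
  by have [] := IH' (del c R) (del k1 C) (del_sub _ _) (del_sub _ _) nR (del_out _ _).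
- apply: none => -[i j] /and4P[/= Ri Cj gij _]; split.
    by apply: contraNneq Rr => <-.
  by apply: contraNneq Ck => <-.
Qed.

End Fan.

(** * Contracting the tail of a fan *)

Section FanTail.
Variables (g : nat -> nat -> bool) (s : nat) (Es : seq (nat * nat)).
Hypothesis s_gt0 : 0 < s.
Hypothesis g_tail : forall i j, s < i -> g i j = (j == i.-1) || (j == i).
Hypothesis g_center : forall i j, 0 < i <= s -> s < j -> g i j = (i == s).
Hypothesis gss : g s s.
Hypothesis Es_le : forall x, x \in Es -> x.1 <= s /\ x.2 <= s.

Lemma g_big_col i j : 0 < i -> s < j -> g i j -> [\/ i = s, i = j | i = j.+1].
Proof.
move=> i0 sj; case: (leqP i s) => si; first by rewrite g_center ?i0 // => /eqP; constructor 1.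
by rewrite g_tail // => /orP[]/eqP ji; [constructor 3; lia|constructor 2].
Qed.

(** The tail is a fan with hub row [s] whose innermost spoke is column [s] itself. The cascade may
    end by marking [(s, s)], so the base case admits that cell among the marked ones. *)
Lemma tail_fan_good L R C E :
  (forall R C E, (forall i, R i -> range s i) -> (forall j, C j -> range s j) ->
     (forall x, E x -> x \in (s, s) :: Es) -> good (meet g) (sub g R C E)) ->
  (forall i, R i -> range (s + L) i) -> (forall j, C j -> range (s + L) j) ->
  (forall x, E x -> x \in Es) -> good (meet g) (sub g R C E).
Proof.
move=> base RL CL EEs.
have [] // := @fan_good g s (addn s) (addn s) L (range (s + L)) (range (s + L)) E
  _ _ _ _ _ _ _ _ L R C (leqnn _).
- move=> [|i] iL _; first by rewrite addn0.
  by rewrite g_center ?s_gt0 ?leqnn //; lia.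
- by move=> [//|i] iL; rewrite !g_tail ?eqxx ?orbT /=; lia.
- by move=> [//|i] y iL _; rewrite g_tail; [case/orP => /eqP; lia|lia].
- move=> [//|i] x iL /andP[x0 xL] /(g_big_col x0)[]; first by lia.
  + by constructor 1.
  + by constructor 2.
  + by move=> xE; constructor 3; lia.
- by move=> i iL; lia.
- by move=> i iL; lia.
- by move=> i x iL /EEs/Es_le[x1 x2]; split; apply/eqP => E'; [move: x1|move: x2]; rewrite E'; lia.
- move=> R1 C1 [R1L C1L out].
  have Rs i : R1 i -> range s i.
    move=> Ri; have /andP[i0 iL] := R1L _ Ri; rewrite /range i0 leqNgt; apply/negP => si.
    by have /andP[] := out (i - s) ltac:(lia); rewrite subnKC ?Ri // ltnW.
  have Cs i : C1 i -> range s i.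
    move=> Ci; have /andP[i0 iL] := C1L _ Ci; rewrite /range i0 leqNgt; apply/negP => si.
    by have /andP[_] := out (i - s) ltac:(lia); rewrite subnKC ?Ci // ltnW.
  split; apply: base => // x; first by move/EEs; rewrite inE orbC => ->.
  by rewrite addn0 /add => /orP[/eqP->|/EEs]; rewrite inE ?eqxx // orbC => ->.
- by split=> // i /andP[iL]; rewrite leqNgt iL.
Qed.

Section Step.
Variables (t : nat) (R C : pred nat) (E : pred (nat * nat)).
Hypothesis st : s < t.
Hypotheses (Rt : forall i, R i -> range t.+1 i) (Ct : forall j, C j -> range t.+1 j).
Hypothesis (EEs : forall x, E x -> x \in Es).
Hypotheses (R1 : R t.+1) (C1 : C t.+1) (R0 : R t) (C0 : C t) (Rs : R s).

Let U := sub g (del t.+1 R) (del t.+1 C) (add (t, t) E).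
Let V := sub g R C (add (t.+1, t.+1) E).
(** With [(t + 1, t + 1)] marked, the cells of [V] outside [U] form the path [(s, t + 1)],
    [(t + 1, t)], [(t, t)]. It contracts to [(s, t)], while the mark moves to [(t, t)]. *)
Let p := (s, t).
Let p2 := (s, t.+1).
Let q := (t, t).
Let v := (t.+1, t).

Let gs j : s < j -> g s j. Proof. by move=> sj; rewrite g_center ?s_gt0 ?leqnn ?eqxx. Qed.
Let gt j : g t j = (j == t.-1) || (j == t). Proof. exact: g_tail. Qed.
Let gt1 j : g t.+1 j = (j == t) || (j == t.+1). Proof. by rewrite g_tail //; lia. Qed.

Let gs' j : (j == t.-1) || (j == t) -> g s j.
Proof.
move=> jt; have [->//|sj] : j = s \/ s < j by case/orP: jt => /eqP; lia.
exact: gs.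
Qed.

Let nE x : s < x.1 \/ s < x.2 -> E x = false.
Proof. by case=> sx; apply/negP => /EEs/Es_le[x1 x2]; [move: (leq_trans sx x1)|move: (leq_trans sx x2)]; rewrite ltnn. Qed.

Let U_in x : U x -> [/\ 0 < x.1 <= t, 0 < x.2 <= t, g x.1 x.2 & x != (t, t)].
Proof.
case/and4P => /andP[/Rt/andP[i0 i1] i2] /andP[/Ct/andP[j0 j1] j2] -> /norP[-> _].
by split=> //; [move: i0 i1 i2|move: j0 j1 j2]; clear; lia.
Qed.

Let col_t i : 0 < i <= t -> g i t -> i = s \/ i = t.
Proof.
move=> /andP[i0 it] /(g_big_col i0 st)[->|->|Ei]; [by left|by right|].
by move: it; rewrite Ei ltnn.
Qed.

Let col_t1 i : 0 < i <= t -> g i t.+1 -> i = s.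
Proof. move=> /andP[i0 it] /(g_big_col i0 (leqW st))[|Ei|Ei] //; move: it; rewrite Ei; clear; lia. Qed.

Let VE x : V x = [|| U x, x == p2, x == q | x == v].
Proof.
case: x => i j; rewrite /V /U /sub /del /add /p2 /q /v /= !xpair_eqE.
case: (eqVneq i t.+1) => [->|it1].
  rewrite R1 gt1 !andbF /=.
  have -> : (t.+1 == s) = false by move: st; clear; lia.
  have -> : (t.+1 == t) = false by clear; lia.
  rewrite nE; last by left => /=; move: st; clear; lia.
  case: (eqVneq j t.+1) => [->|jt1] /=; first by rewrite andbF; clear; lia.
  by case: (eqVneq j t) => [->|_]; rewrite ?C0 ?andbF.
rewrite !andbT orbF.
case: (eqVneq j t.+1) => [->|jt1].
  have -> : (t.+1 == t) = false by clear; lia.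
  rewrite C1 nE; last by right => /=; move: st; clear; lia.
  rewrite !andbF /= !andbT !orbF.
  case Ri: (R i) => /=.
    have /andP[i0 it] := Rt Ri.
    have it' : 0 < i <= t by move: i0 it it1; clear; lia.
    apply/idP/eqP => [/(col_t1 it') //|->]; apply: gs; move: st; clear; lia.
  by case: eqP => // Ei; rewrite Ei Rs in Ri.
rewrite !andbF !andbT /=.
case: (eqVneq i t) => [->|it] /=; last by rewrite orbF.
case: (eqVneq j t) => [->|jt] /=; last by rewrite orbF.
by rewrite R0 C0 gt eqxx orbT nE ?andbF //; left.
Qed.

Let Up : U p.
Proof.
rewrite /U /sub /del /p /= Rs C0 gs // /add xpair_eqE nE; last by right.
by move: st; clear; lia.
Qed.

Let step_hyps :
  [/\ ~~ U p2, ~~ U q & ~~ U v] /\ [/\ p2 != q, p2 != v & q != v].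
Proof.
rewrite /U /sub /del /p2 /q /v /add /= !eqxx /= !andbF !xpair_eqE.
by split; split=> //; move: st; clear; lia.
Qed.

Let Np2 x : U x -> meet g p2 x -> meet g p x.
Proof.
move=> /U_in[xr _ _ _] /andP[/= g1 /(col_t1 xr) x1].
by rewrite /meet /p /= g1 x1 gs.
Qed.

Let Nq x : U x -> meet g q x -> meet g p x.
Proof. by move=> _ /andP[/=]; rewrite gt => /gs' g1 g2; rewrite /meet /= g1 g2. Qed.

Let Nv x : U x -> meet g v x -> x = p.
Proof.
case: x => i j /U_in[/= ir jr gij nt] /andP[/=]; rewrite gt1 => jE /(col_t ir) iE.
have Ej : j = t by case/orP: jE jr => /eqP-> //; rewrite ltnn andbF.
by case: iE nt => ->; rewrite Ej // eqxx.
Qed.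

Let edges : [/\ ~~ meet g q p2, meet g q v, meet g v p2 & meet g v p].
Proof.
rewrite /meet /q /v /p2 /p /= !gt !gt1 !gs // !eqxx !orbT /=; split=> //.
by move: st; clear; lia.
Qed.

Let dich x y : U x -> U y -> meet g p x -> meet g p y -> meet g x y ->
  meet g p2 x || meet g q y.
Proof.
case: x y => [i j] [i' j'] /U_in[/= ir jr gij nt] /U_in[/= ir' jr' gij' nt'].
rewrite /meet /= => /andP[gsj /(col_t ir) iE] /andP[gsj' git'] /andP[gij'' _].
case: iE => [->|Ei]; first by rewrite gsj gs //; move: st; clear; lia.
by rewrite -{2}Ei gij'' git' orbT.
Qed.

Lemma tail_contract_good : good (meet g) U -> good (meet g) V.
Proof.
have [[n1 n2 n3] [d1 d2 d3]] := step_hyps; have [e1 e2 e3 e4] := edges.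
have adjxx x : V x -> meet g x x by apply: sub_meet.
exact: (good_contract (@meetC g) adjxx Up n1 n2 n3 d1 d2 d3 VE Np2 Nq Nv e1 e2 e3 dich).
Qed.

Lemma tail_contract_gap : gap (meet g) U -> gap (meet g) V.
Proof.
have [[n1 n2 n3] [d1 d2 d3]] := step_hyps; have [e1 e2 e3 e4] := edges.
have adjxx x : V x -> meet g x x by apply: sub_meet.
exact: (gap_contract (@meetC g) adjxx Up n1 n2 n3 d1 d2 d3 VE Np2 Nq Nv e1 e2 e3 dich).
Qed.

End Step.

Definition good_base := forall R C E,
  (forall i, R i -> range s i) -> (forall j, C j -> range s j) ->
  (forall x, E x -> x \in (s, s) :: Es) -> good (meet g) (sub g R C E).

(** Contraction stops at a tail of one row with its end marked; the configuration with the gap is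
    left out. *)
Definition good_base1 := forall R C E,
  (forall i, R i -> range s.+1 i) -> (forall j, C j -> range s.+1 j) ->
  (forall x, E x -> x \in Es) ->
  ~ [/\ full s.+1 R, full s.+1 C & forall x, x \in Es -> E x] ->
  good (meet g) (sub g R C (add (s.+1, s.+1) E)).

(** As long as row [s], the last but one row and the last but one column are kept, the tail
    contracts by one. If one of them is missing, the marked end no longer blocks elimination, and
    the fan cascade consumes the tail. *)
Lemma tail_path_good l R C E : good_base -> good_base1 ->
  (forall i, R i -> range (s + l.+1) i) -> (forall j, C j -> range (s + l.+1) j) ->
  (forall x, E x -> x \in Es) -> R (s + l.+1) -> C (s + l.+1) ->
  ~ [/\ full (s + l.+1) R, full (s + l.+1) C & forall x, x \in Es -> E x] ->
  good (meet g) (sub g R C (add (s + l.+1, s + l.+1) E)).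
Proof.
move=> base base1; elim: l R C => [|l IH] R C Rt Ct EEs R1 C1 nf.
  by move: Rt Ct R1 C1 nf; rewrite addn1 => Rt Ct _ _; apply: base1.
move: IH Rt Ct R1 C1 nf; rewrite (addnS s l.+1); set t := s + l.+1.
have st : s < t by rewrite /t; lia.
move=> IH Rt Ct R1 C1 nf.
have row1 j : C j -> g t.+1 j -> j = t \/ j = t.+1.
  by move=> Cj; rewrite g_tail => [/orP[]/eqP->|]; [left|right|lia].
have col i k : R i -> s < k -> g i k -> [\/ i = s, i = k | i = k.+1].
  by move=> /Rt/andP[i0 _] sk; apply: g_big_col.
have nE i j : s < i \/ s < j -> E (i, j) = false.
  by case=> sx; apply/negP => /EEs/Es_le[/= x1 x2]; [move: (leq_trans sx x1)|move: (leq_trans sx x2)]; rewrite ltnn.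
have fan R' C' : (forall i, R' i -> R i) -> (forall j, C' j -> C j) ->
    good (meet g) (sub g R' C' E).
  move=> RR CC; apply: (@tail_fan_good l.+2) => //.
    by move=> i /RR/Rt; rewrite addnS.
  by move=> i /CC/Ct; rewrite addnS.
have col1 i : R i -> g i t.+1 -> i = s \/ i = t.+1.
  move=> Ri /(col _ _ Ri (leqW st))[|->|Ei]; [by left|by right|].
  by have := Rt _ Ri; rewrite /range Ei; lia.
(* Without column [t], row [t + 1] is left with its marked end only, so it carries no cell. *)
case: (boolP (C t)) => C0; last first.
  apply: good_ext (fan (del t.+1 R) C _ _) => //; last by move=> i /andP[].
  move=> [i j]; rewrite /sub /del /add /= xpair_eqE.
  case: (R i) => //=; case Cj: (C j); rewrite ?andbF //=.
  case: (eqVneq i t.+1) => [->|_] //=; case gij: (g t.+1 j) => //=.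
  case: (row1 j Cj gij) => Ej; last by rewrite Ej eqxx.
  by move: Cj; rewrite Ej (negPf C0).
case: (boolP (R s)) => Rs; last first.
  apply: good_ext (fan R (del t.+1 C) _ _) => //; last by move=> i /andP[].
  move=> [i j]; rewrite /sub /del /add /= xpair_eqE.
  case Ri: (R i) => //=; case: (C j) => //=.
  case: (eqVneq j t.+1) => [->|_] /=; last by rewrite andbF.
  case gij: (g i t.+1) => //=.
  case: (col1 i Ri gij) => Ei; last by rewrite Ei eqxx.
  by move: Ri; rewrite Ei (negPf Rs).
have gst k : s < k -> g s k by move=> sk; rewrite g_center ?s_gt0 ?leqnn ?eqxx.
have g1t : g t.+1 t by rewrite g_tail ?eqxx //; lia.
have g11 : g t.+1 t.+1 by rewrite g_tail ?eqxx ?orbT //; exact: leqW.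
have [gs0 gs1] : g s t /\ g s t.+1 by split; apply: gst => //; exact: leqW.
(* Without row [t], the cell [(t + 1, t)] is simplicial: its neighbours lie in the all-one square on
   rows [s], [t + 1] and columns [t], [t + 1]. *)
case: (boolP (R t)) => R0; last first.
  have colt i : R i -> g i t -> i = s \/ i = t.+1.
    by move=> Ri /(col _ _ Ri st)[->|Ei|->]; [left| |right] => //; rewrite -Ei Ri in R0.
  pose R' := del t.+1 R; pose C' := del t (del t.+1 C).
  apply: (good_simplicial (e := (t.+1, t)) (V := sub g R' C' E) (@meetC g)).
  - by rewrite /sub /add /= R1 C0 g1t xpair_eqE nE ?orbF; [clear; lia|left; exact: leqW].
  - by rewrite /meet /= g1t.
  - move=> [i j] [i' j'] /and4P[/= Ri Cj _ _] /and4P[/= Ri' Cj' _ _].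
    rewrite /meet /= => /andP[/(row1 _ Cj) jE /(colt _ Ri) iE].
    move=> /andP[/(row1 _ Cj') jE' /(colt _ Ri') iE'].
    have gg a b : a = s \/ a = t.+1 -> b = t \/ b = t.+1 -> g a b.
      by move=> [->|->] [->|->].
    by rewrite !gg.
  - move=> [i j]; rewrite /sub /R' /C' /del /add /meet /= xpair_eqE.
    case Ri: (R i) => //=; case Cj: (C j); rewrite ?andbF //=.
    case gij: (g i j); rewrite ?andbF //=.
    case: (eqVneq i t.+1) => [Ei|it1] /=.
      by move: gij; rewrite Ei => ->; rewrite g1t andbF.
    case: (eqVneq j t.+1) => [Ej|jt1] /=.
      move: gij; rewrite Ej => /(col1 _ Ri)[Ei|Ei]; last by rewrite Ei eqxx in it1.
      by rewrite Ei g11 gs0 andbF.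
    case: (eqVneq j t) => [Ej|jt] /=.
      by move: gij; rewrite Ej => ->; rewrite g1t andbF.
    have -> : g t.+1 j = false.
      by apply/negP => /(row1 _ Cj)[] E'; [move: jt|move: jt1]; rewrite E' eqxx.
    by rewrite andbT.
  - by apply: fan => i; [case/andP|case/andP => /andP[]].
apply: tail_contract_good => //; apply: IH => //.
- by move=> i /andP[/Rt]; rewrite /range; clear; lia.
- by move=> i /andP[/Ct]; rewrite /range; clear; lia.
- by rewrite /del R0 neq_ltn ltnSn.
- by rewrite /del C0 neq_ltn ltnSn.
- move=> [fR fC fE]; apply: nf; split=> // i ir; case: (eqVneq i t.+1) => [->//|it].
    by have /fR/andP[] : range t i by move: ir it; rewrite /range; clear; lia.
  by have /fC/andP[] : range t i by move: ir it; rewrite /range; clear; lia.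
Qed.

Lemma tail_path_gap l :
  gap (meet g) (sub g (range s.+1) (range s.+1) (add (s.+1, s.+1) (mem Es))) ->
  gap (meet g) (sub g (range (s + l.+1)) (range (s + l.+1)) (add (s + l.+1, s + l.+1) (mem Es))).
Proof.
move=> G; elim: l => [|l IH]; first by rewrite addn1.
rewrite (addnS s l.+1); set t := s + l.+1 in IH *.
have st : s < t by rewrite /t; lia.
apply: tail_contract_gap => //; try by rewrite /range; lia.
apply: gap_ext IH => x; rewrite /sub.
have dE i : range t i = del t.+1 (range t.+1) i by rewrite /del /range; lia.
by rewrite !dE.
Qed.

(** Only an end cell that is present and marked makes the tail a path to be contracted. In the other
    cases its mark has no effect and the cascade starts at the end. *)
Lemma tail_good l R C E : good_base -> good_base1 ->
  (forall i, R i -> range (s + l.+1) i) -> (forall j, C j -> range (s + l.+1) j) ->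
  (forall x, E x -> x \in rcons Es (s + l.+1, s + l.+1)) ->
  ~ [/\ full (s + l.+1) R, full (s + l.+1) C & forall x, x \in rcons Es (s + l.+1, s + l.+1) -> E x] ->
  good (meet g) (sub g R C E).
Proof.
move=> base base1; set t := s + l.+1 => RL CL EEs nf.
have tEs : (t, t) \notin Es by apply/negP => /Es_le[/=]; rewrite /t; lia.
pose E' x := E x && (x != (t, t)).
have E'Es x : E' x -> x \in Es.
  by case/andP => /EEs; rewrite mem_rcons inE => /orP[->|].
case: (boolP [&& R t, C t & E (t, t)]) => [/and3P[Rt Ct Et]|nRCE].
  apply: (good_sub_ext (E := add (t, t) E')) => [//|//|x _ _ _|].
    by rewrite /add /E'; case: (eqVneq x (t, t)) => [->|]; rewrite ?Et ?andbT.
  apply: tail_path_good => // -[fR fC fE]; apply: nf; split=> // x.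
  by rewrite mem_rcons inE => /predU1P[->//|/fE/andP[]].
apply: (good_sub_ext (E := E')) => [//|//|x Rx Cx gx|].
  rewrite /E'; case: (eqVneq x (t, t)) => [Ex|]; rewrite ?andbF ?andbT //.
  by apply/esym/negbTE; move: nRCE; rewrite Ex /= in Rx Cx *; rewrite Rx Cx.
exact: (@tail_fan_good l.+1).
Qed.

End FanTail.

Lemma good_base_check g certs s Es :
  check_all g certs (iota 1 s) (iota 1 s) ((s, s) :: Es) (fun _ _ _ => true) ->
  good_base g s Es.
Proof.
move=> H R C E Rs Cs EEs; apply: (check_all_good H) => // i.
  by rewrite mem_iota add1n ltnS => /Rs.
by rewrite mem_iota add1n ltnS => /Cs.
Qed.

Lemma good_base1_check g certs s Es :
  check_all g certs (iota 1 s.+1) (iota 1 s.+1) ((s.+1, s.+1) :: Es)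
    (fun mr mc me => ohead me && ~~ [&& all id mr, all id mc & all id me]) ->
  (s.+1, s.+1) \notin Es -> good_base1 g s Es.
Proof.
move=> H sEs R C E Rs Cs EEs nf.
have rangeE k i : (i \in iota 1 k) = range k i by rewrite mem_iota add1n ltnS.
apply: (check_all_good H) => [i|i|x|].
- by rewrite rangeE => /Rs.
- by rewrite rangeE => /Cs.
- by rewrite /add inE => /orP[->|/EEs->]; rewrite ?orbT.
rewrite /= /add eqxx /=; apply/negP => /and3P[aR aC aE]; apply: nf.
have aP (P : pred nat) : P 1 && all id (map P (iota 2 s)) -> full s.+1 P.
  rewrite all_map => /andP[P1 /allP aP] i; rewrite /range => /andP[i0 i1].
  case: (eqVneq i 1) => [->//|i2]; apply: aP; rewrite mem_iota; lia.
split; [exact: aP|exact: aP|move=> x xE].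
move: aE; rewrite all_map => /allP/(_ x xE) /= /orP[/eqP Ex|//].
by rewrite -Ex xE in sEs.
Qed.

Lemma gap_check g (U E : seq (nat * nat)) k :
  all_masks (size U) (fun m => let A := mask m U in
    all (fun x => all (fun y => (x != y) ==> ~~ meet g x y) A) A ==> (size A <= k)) ->
  all (mem U) E -> uniq E -> size E = k.*2.+1 ->
  all (fun x => all (fun y => all (fun z => [&& x != y, x != z & y != z] ==>
     ~~ [&& meet g x y, meet g x z & meet g y z]) E) E) E ->
  gap (meet g) (mem U).
Proof.
move=> alpha /allP EU uE sE /allP tri; apply: (gap_intro_triple _ EU uE sE).
  move=> A uA AU iA.
  have /= := all_masksP alpha (size_map (mem A) U).
  rewrite -filter_mask; set B := filter _ _.
  have BA : {subset B <= A} by move=> x; rewrite mem_filter => /andP[].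
  have -> /= : all (fun x => all (fun y => (x != y) ==> ~~ meet g x y) B) B.
    by apply/allP => x /BA xA; apply/allP => y /BA yA; apply/implyP; apply: iA.
  apply: leq_trans; apply: uniq_leq_size uA _ => x xA.
  by rewrite mem_filter /= xA; apply: AU.
move=> x y z xE yE zE xy xz yz.
by have /allP/(_ y yE)/allP/(_ z zE) := tri x xE; rewrite xy xz yz.
Qed.

(** * The matrices [D_n] and [T_n] *)

Lemma sub_cells g R C (E : pred (nat * nat)) rs cs :
  (forall i, R i = (i \in rs)) -> (forall j, C j = (j \in cs)) ->
  sub g R C E =1
  mem [seq x <- [seq (i, j) | i <- rs, j <- cs] | g x.1 x.2 && ~~ E x].
Proof.
move=> Rrs Ccs [i j]; rewrite /sub /= mem_filter /= Rrs Ccs.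
rewrite andbA [RHS]andbC; congr (_ && _).
by apply/andP/allpairsP => [[? ?]|[[? ?] [/= ? ? [-> ->]]]] //; exists (i, j).
Qed.

Definition Es12 : seq (nat * nat) := [:: (1, 2); (2, 1)].

Lemma tail_stretch_minimally_non_firm f g s l :
  1 < s ->
  (forall i j, s < i -> g i j = (j == i.-1) || (j == i)) ->
  (forall i j, 0 < i <= s -> s < j -> g i j = (i == s)) ->
  g s s -> g 1 2 -> g 2 1 ->
  (forall i j, range (s + l.+1) i -> range (s + l.+1) j -> g i j = f i j) ->
  good_base g s Es12 -> good_base1 g s Es12 ->
  gap (meet g) (sub g (range s.+1) (range s.+1) (add (s.+1, s.+1) (mem Es12))) ->
  minimally_non_firm (stretch (s + l.+1) (s + l.+1) (Qs (s + l.+1)) f).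
Proof.
move=> s1 g_tail g_center gss g12 g21 fg base base1 G; set t := s + l.+1 in fg *.
have Es_le x : x \in Es12 -> x.1 <= s /\ x.2 <= s.
  by rewrite !inE => /orP[]/eqP->; rewrite /= s1 ltnW.
have st : s < t by rewrite /t; lia.
have QE x : (x \in Qs t) = (x \in rcons Es12 (t, t)) by [].
apply: stretch_minimally_non_firm.
- move=> x; rewrite !inE => /or3P[]/eqP-> /=; rewrite -fg /range; try by lia.
  + by rewrite g12; split=> //; lia.
  + by rewrite g21; split=> //; lia.
  + by rewrite g_tail // eqxx orbT; split=> //; lia.
- by rewrite /= !inE !xpair_eqE; lia.
- apply: gap_agree fg _.
  apply: gap_ext (tail_path_gap (ltnW s1) g_tail g_center gss Es_le l G) => x.
  by rewrite /sub /add [mem (Qs t) x]QE mem_rcons inE.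
move=> R C E Rt Ct EQ nf; apply: (good_agree (g := g)).
  by move=> i j /Rt ri /Ct rj; apply: fg.
exact: (tail_good (ltnW s1) g_tail g_center gss Es_le base base1 Rt Ct EQ nf).
Qed.

(* [D_n] and [T_n] without their bound on the indices. *)
Definition Dg i j := Df (i + j) i j.
Definition Tg i j := Tf (i + j) i j.

(** In both entries the cells other than [(3, 3)] form a chordless 4-cycle, where no cell is
    simplicial; the two cliques contain opposite edges of it. *)
Definition D_certs : seq (seq (nat * nat) * seq (seq (nat * nat))) :=
  [:: ([:: (1, 3); (3, 4)], [:: [:: (1, 3); (3, 2); (3, 3)]; [:: (3, 4); (4, 3)]]);
      ([:: (2, 3); (3, 4)], [:: [:: (2, 3); (3, 1); (3, 3)]; [:: (3, 4); (4, 3)]])].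

Definition T_certs : seq (seq (nat * nat) * seq (seq (nat * nat))) :=
  [:: ([:: (1, 4); (3, 3)], [:: [:: (1, 4); (3, 2); (3, 4)]; [:: (3, 3); (4, 4)]]);
      ([:: (2, 3); (4, 4)], [:: [:: (2, 3); (3, 3); (4, 3)]; [:: (4, 1); (4, 4)]]);
      ([:: (1, 4); (3, 3); (4, 1)],
       [:: [:: (1, 4); (3, 2); (3, 4)]; [:: (2, 3); (3, 3); (4, 3)]; [:: (4, 1); (4, 4)]]);
      ([:: (1, 4); (3, 3); (4, 5)],
       [:: [:: (1, 4); (3, 2); (3, 4)]; [:: (3, 3); (4, 3); (4, 4)]; [:: (4, 5); (5, 4)]]);
      ([:: (2, 3); (3, 4); (4, 5)],
       [:: [:: (2, 3); (3, 3); (4, 3)]; [:: (3, 4); (4, 4); (5, 4)]; [:: (4, 1); (4, 5)]])].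

Lemma D_base : good_base Dg 3 Es12.
Proof. by apply: (@good_base_check _ D_certs); vm_compute. Qed.
Lemma D_base1 : good_base1 Dg 3 Es12.
Proof. by apply: (@good_base1_check _ D_certs); vm_compute. Qed.

Lemma T_base : good_base Tg 4 Es12.
Proof. by apply: (@good_base_check _ T_certs); vm_compute. Qed.

Lemma T_base1 : good_base1 Tg 4 Es12.
Proof. by apply: (@good_base1_check _ T_certs); vm_compute. Qed.

Lemma D_gap : gap (meet Dg) (sub Dg (range 4) (range 4) (add (4, 4) (mem Es12))).
Proof.
apply: (@gap_ext _ _ (mem [seq x <- [seq (i, j) | i <- iota 1 4, j <- iota 1 4] |
    Dg x.1 x.2 && ~~ add (4, 4) (mem Es12) x])).
  by move=> x; rewrite -(@sub_cells _ (range 4) (range 4)) // => i;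
     rewrite mem_iota add1n ltnS.
(* These cells, in this order, form a chordless 5-cycle. *)
by apply: (@gap_check _ _ [:: (1, 3); (2, 2); (3, 1); (3, 4); (4, 3)] 2); vm_compute.
Qed.

Lemma T_gap : gap (meet Tg) (sub Tg (range 5) (range 5) (add (5, 5) (mem Es12))).
Proof.
apply: (@gap_ext _ _ (mem [seq x <- [seq (i, j) | i <- iota 1 5, j <- iota 1 5] |
    Tg x.1 x.2 && ~~ add (5, 5) (mem Es12) x])).
  by move=> x; rewrite -(@sub_cells _ (range 5) (range 5)) // => i;
     rewrite mem_iota add1n ltnS.
(* A chordless 7-cycle, in the order [(1, 4)], [(3, 2)], [(3, 3)], [(2, 3)], [(4, 1)], [(4, 5)],
   [(5, 4)]. *)
by apply: (@gap_check _ _ [:: (1, 4); (2, 3); (3, 2); (3, 3); (4, 1); (4, 5); (5, 4)] 3);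
   vm_compute.
Qed.

Lemma D_minimally_non_firm n : 4 <= n -> minimally_non_firm (stretch n n (Qs n) (Df n)).
Proof.
move=> hn; have -> : n = 3 + (n - 4).+1 by lia.
apply: (@tail_stretch_minimally_non_firm _ Dg) => //.
- by move=> i j i3; rewrite /Dg /Df; lia.
- by move=> i j i3 j3; rewrite /Dg /Df; lia.
- by move=> i j; rewrite /range /Dg /Df; lia.
- exact: D_base.
- exact: D_base1.
- exact: D_gap.
Qed.

Lemma T_minimally_non_firm n : 4 <= n ->
  minimally_non_firm (stretch n.+1 n.+1 (Qs n.+1) (Tf n.+1)).
Proof.
move=> hn; have -> : n.+1 = 4 + (n - 4).+1 by lia.
apply: (@tail_stretch_minimally_non_firm _ Tg) => //.
- by move=> i j i3; rewrite /Tg /Tf; lia.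
- by move=> i j i3 j3; rewrite /Tg /Tf; lia.
- by move=> i j; rewrite /range /Tg /Tf; lia.
- exact: T_base.
- exact: T_base1.
- exact: T_gap.
Qed.

(** * Broken wheels *)

(* Rows are 0 for the hub, 1 for the line that makes [M_(t+1)] out of [C_t], 2 for
   column [t] of [C_t] and [i + 2] for its column [i < t]; columns are 0 for row [t] of
   [C_t], 1 for the line that makes [M_(t+1)], 2 for row [t - 1] of [C_t] and [i + 2]
   for its row [i < t - 1]. Thus the labels up to 3 do not depend on [t]. *)
Definition wheel (t i j : nat) : bool :=
  if i == 0 then j != 1 else
  if i == 1 then j <= 1 else
  if i == 2 then j <= 2 else
  if i == 3 then (j == 0) || (j == 3) else
  (j == i.-1) || (j == (if i == t.+1 then 2 else i)).

Definition wheel_certs : seq (seq (nat * nat) * seq (seq (nat * nat))) :=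
  [:: ([:: (0, 0); (2, 1)], [:: [:: (0, 0); (1, 0); (2, 0)]; [:: (2, 1); (2, 2)]])].

(** The images of the cells to be stretched: [(3, 0)] and [(2, 0)] come from [G_t], and [(1, 1)]
    from the corner of [M_n]. *)
Definition wheel_E : seq (nat * nat) := [:: (3, 0); (2, 0); (1, 1)].

(** [(0, 2)] and [(0, 3)] are the innermost spokes of the fans into which a broken rim falls, so the
    cascades may have marked them. *)
Lemma wheel_base t R C E : (forall i, R i -> i <= 3) -> (forall j, C j -> j <= 3) ->
  (forall x, E x -> x \in [:: (0, 2), (0, 3) & wheel_E]) ->
  good (meet (wheel t)) (sub (wheel t) R C E).
Proof.
move=> R3 C3 EE; apply: (good_agree (g := wheel 3)) => [i j /R3 i3 /C3 j3|].
  by case: i i3 => [|[|[|[|i]]]].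
apply: (@check_all_good _ wheel_certs (iota 0 4) (iota 0 4)
  [:: (0, 2), (0, 3) & wheel_E] (fun _ _ _ => true)) => [|i|j||//].
- by vm_compute.
- by rewrite mem_iota; apply: R3.
- by rewrite mem_iota; apply: C3.
- exact: EE.
Qed.

Section Wheel.
Variable t : nat.
Hypothesis t3 : 3 <= t.
Let g := wheel t.

Lemma wheel0 j : g 0 j = (j != 1). Proof. by []. Qed.

Lemma wheel_row i j : 3 < i -> g i j = (j == i.-1) || (j == (if i == t.+1 then 2 else i)).
Proof. by case: i => [|[|[|[|i]]]]. Qed.

Lemma wheel_col i j : 2 < j <= t -> g i j -> [\/ i = 0, i = j | i = j.+1].
Proof.
move=> /andP[j2 jt]; case: (leqP i 3) => i3; last first.
  rewrite wheel_row // => /orP[/eqP->|]; first by constructor 3; lia.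
  by case: ifP => _ /eqP E; [move: j2; rewrite E|constructor 2].
case: i i3 => [|[|[|[|i]]]] // _; rewrite /g /wheel /=; first by constructor 1.
- by move=> j1; exfalso; lia.
- by move=> j1; exfalso; lia.
- by move=> j1; constructor 2; lia.
Qed.

Lemma wheel_col2 i : g i 2 -> [\/ i = 0, i = 2 | i = t.+1].
Proof.
case: (leqP i 3) => i3; last first.
  rewrite wheel_row // => /orP[/eqP E|]; first by exfalso; lia.
  by case: ifP => [/eqP-> _|_ /eqP E]; [constructor 3|exfalso; lia].
by case: i i3 => [|[|[|[|i]]]] // _ _; [constructor 1|constructor 2].
Qed.

Variables (R0 C0 : pred nat) (E : pred (nat * nat)).
Hypotheses (R0t : forall i, R0 i -> i <= t.+1) (C0t : forall j, C0 j -> j <= t).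
Hypothesis E_wheel : forall x, E x -> x \in wheel_E.

Let E_le x (F : pred (nat * nat)) : (forall x, F x -> x = (0, 2) \/ x = (0, 3) \/ E x) -> F x ->
  x.1 <= 3 /\ x.2 <= 3.
Proof.
move=> FE /FE[->|[->|/E_wheel]] //.
by rewrite !inE => /or3P[]/eqP->.
Qed.

Let E_le2 x : E x -> x.1 <= 3 /\ x.2 <= 1.
Proof. by move/E_wheel; rewrite !inE => /or3P[]/eqP->. Qed.

Let wheel_base' R C (F : pred (nat * nat)) : (forall i, R i -> R0 i) -> (forall j, C j -> C0 j) ->
  (forall i, 3 < i <= t.+1 -> ~~ R i) -> (forall i, 3 < i <= t -> ~~ C i) ->
  (forall x, F x -> x = (0, 2) \/ x = (0, 3) \/ E x) ->
  good (meet g) (sub g R C F).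
Proof.
move=> RR CC nR nC FE; apply: wheel_base => [i Ri|j Cj|x /FE].
- rewrite leqNgt; apply/negP => i3.
  by have := nR i; rewrite i3 (R0t (RR _ Ri)) Ri => /(_ isT).
- rewrite leqNgt; apply/negP => j3.
  by have := nC j; rewrite j3 (C0t (CC _ Cj)) Cj => /(_ isT).
- by move=> [->|[->|/E_wheel]]; rewrite ?inE // => ->; rewrite !orbT.
Qed.

Lemma wheel_fan1 x R C (F : pred (nat * nat)) : 3 < x <= t.+1 ->
  (forall i, R i -> R0 i) -> (forall j, C j -> C0 j) -> ~~ R x ->
  (forall i, x < i <= t.+1 -> ~~ R i) -> (forall i, x <= i <= t -> ~~ C i) ->
  (forall y, F y -> y = (0, 2) \/ E y) ->
  good (meet g) (sub g R C F).
Proof.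
move=> /andP[x3 xt] RR CC nx nR nC FE.
have F2 y : F y -> y.1 <= 3 /\ y.2 <= 3.
  by apply: E_le => z /FE[]; [left|right; right].
have [] // := @fan_good g 0 (addn 3) (addn 3) (x - 4) R C F _ _ _ _ _ _ _ _ (x - 4) R C (leqnn _).
- case=> [|i] iL; first by case/andP: iL.
  rewrite !wheel_row /=; try lia.
  by case: ifP => Ei; lia.
- case=> [|i] y iL; first by case/andP: iL.
  move=> Cy; rewrite wheel_row; last by lia.
  by case: ifP => Ei /orP[]/eqP->; lia.
- move=> i y iL Ry /wheel_col [|->|->|Ey]; first by lia.
  + by constructor 1.
  + by constructor 2.
  + constructor 3; split; last by lia.
    have : y != x by apply: contraNneq nx => <-.
    by lia.
- by move=> i iL; lia.
- by move=> i y iL /F2[y1 y2]; split; apply/eqP => Ey; [move: y1|move: y2]; rewrite Ey; lia.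
- move=> R1 C1 [R1R C1C out].
  have nR1 i : 3 < i <= t.+1 -> ~~ R1 i.
    move=> it; case: (ltngtP i x) => ix.
    + by have /andP[] := out (i - 3) ltac:(lia); rewrite subnKC //; lia.
    + by apply: contra (@R1R i) (nR i _); lia.
    + by rewrite ix; apply: contra (@R1R x) nx.
  have nC1 i : 3 < i <= t -> ~~ C1 i.
    move=> it; case: (ltnP i x) => ix.
    + by have /andP[_] := out (i - 3) ltac:(lia); rewrite subnKC //; lia.
    + by apply: contra (@C1C i) (nC i _); lia.
  split; apply: wheel_base' => //; try by move=> i /R1R/RR.
  + by move=> i /C1C/CC.
  + by move=> y /FE[]; [left|right; right].
  + by move=> i /C1C/CC.
  + by move=> y; rewrite /add => /orP[/eqP->|/FE[]]; [right; left|left|right; right].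
- by split=> // i /andP[iL]; rewrite leqNgt iL.
Qed.

(** Opening the rim at row [x] leaves two fans with hub row 0. The one attached to column 2, through
    rows [t + 1] down to [x + 1], is consumed here; the one attached to column 3, through rows 4 to
    [x - 1], is left to [wheel_fan1]. *)
Lemma wheel_broken_mid x : 3 < x <= t.+1 -> ~~ R0 x -> good (meet g) (sub g R0 C0 E).
Proof.
move=> /andP[x3 xt] nx; pose k i := if i == 0 then 2 else t.+1 - i.
have [] // := @fan_good g 0 (fun i => t.+2 - i) k (t.+1 - x) R0 C0 E
  _ _ _ _ _ _ _ _ (t.+1 - x) R0 C0 (leqnn _).
- by move=> i iL _; rewrite wheel0 /k; case: ifP => i0; lia.
- case=> [|i] iL; first by case/andP: iL.
  rewrite !wheel_row /k /=; try lia.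
  by case: (eqVneq i 0) => i0; case: ifP => Ei; lia.
- case=> [|i] y iL; first by case/andP: iL.
  move=> Cy; rewrite wheel_row /k /=; last by lia.
  by case: (eqVneq i 0) => i0; case: ifP => Ei; lia.
- case=> [|i] y iL; first by case/andP: iL.
  move=> Ry; rewrite /k /= => /wheel_col [|->|Ey|->]; first by lia.
  + by constructor 1.
  + constructor 3; split; last by lia.
    have : y != x by apply: contraNneq nx => <-.
    by lia.
  + by constructor 2; lia.
- by move=> i iL; lia.
- case=> [|i] iL; first by case/andP: iL.
  by rewrite /k /=; case: (eqVneq i 0); lia.
- move=> i y iL /E_le2[y1 y2]; split; apply/eqP => Ey; [move: y1|move: y2]; rewrite Ey; first by lia.
  by rewrite /k; case: ifP => i0; lia.
- move=> R C [RR CC out].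
  have nR i : x < i <= t.+1 -> ~~ R i.
    by move=> it; have /andP[] := out (t.+2 - i) ltac:(lia); rewrite subKn //; lia.
  have nC i : x <= i <= t -> ~~ C i.
    move=> it; have /andP[_] := out (t.+1 - i) ltac:(lia).
    by rewrite /k ifN ?subKn //; lia.
  have nRx : ~~ R x by apply: contra (@RR x) nx.
  split; apply: (@wheel_fan1 x) => //; try by rewrite x3.
  + by move=> y Ey; right.
  + by move=> y; rewrite /add /k /= => /orP[/eqP->|]; [left|right].
- by split=> // i /andP[iL]; rewrite leqNgt iL.
Qed.

(** Without row 2 there is a single fan: it starts at column 3 and goes round through rows 4 to
    [t + 1], with column 2 as its outermost spoke. Without row 3 the same fan is traversed from
    column 2 to column 3. *)
Lemma wheel_broken2 : ~~ R0 2 -> good (meet g) (sub g R0 C0 E).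
Proof.
move=> n2; pose k i := if i == t - 2 then 2 else 3 + i.
have [] // := @fan_good g 0 (addn 3) k (t - 2) R0 C0 E
  _ _ _ _ _ _ _ _ (t - 2) R0 C0 (leqnn _).
- by move=> i iL _; rewrite wheel0 /k; case: ifP => i0; lia.
- case=> [|i] iL; first by case/andP: iL.
  rewrite !wheel_row /k /=; try lia.
  by case: (eqVneq i.+1 (t - 2)) => Ei; case: (eqVneq i (t - 2)) => Ej; case: ifP => Ek; lia.
- case=> [|i] y iL; first by case/andP: iL.
  move=> Cy; rewrite wheel_row /k /=; last by lia.
  by case: (eqVneq i.+1 (t - 2)) => Ei; case: (eqVneq i (t - 2)) => Ej; case: ifP => Ek; lia.
- move=> i y iL Ry; rewrite /k; case: eqP => [Ei /wheel_col2[->|Ey|->]|ni /wheel_col[|->|->|->]].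
  + by constructor 1.
  + by move: n2; rewrite -Ey Ry.
  + by constructor 2; lia.
  + by lia.
  + by constructor 1.
  + by constructor 2.
  + by constructor 3; split; lia.
- case=> [|i] iL; first by case/andP: iL.
  by rewrite /k /=; case: (eqVneq i.+1 (t - 2)); case: (eqVneq i (t - 2)); lia.
- move=> i y iL /E_le2[y1 y2]; split; apply/eqP => Ey; [move: y1|move: y2]; rewrite Ey; first by lia.
  by rewrite /k; case: ifP => i0; lia.
- move=> R C [RR CC out].
  have nR i : 3 < i <= t.+1 -> ~~ R i.
    by move=> it; have /andP[] := out (i - 3) ltac:(lia); rewrite subnKC //; lia.
  have nC i : 3 < i <= t -> ~~ C i.
    move=> it; have /andP[_] := out (i - 3) ltac:(lia).
    by rewrite /k ifN ?subnKC //; lia.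
  split; apply: wheel_base' => // y; first by right; right.
  by rewrite /add /k ifN ?addn0 => [/orP[/eqP->|]|]; [right; left|right; right|lia].
- by split=> // i /andP[iL]; rewrite leqNgt iL.
Qed.

Lemma wheel_broken3 : ~~ R0 3 -> good (meet g) (sub g R0 C0 E).
Proof.
move=> n3; pose k i := if i == 0 then 2 else t.+1 - i.
have [] // := @fan_good g 0 (fun i => t.+2 - i) k (t - 2) R0 C0 E
  _ _ _ _ _ _ _ _ (t - 2) R0 C0 (leqnn _).
- by move=> i iL _; rewrite wheel0 /k; case: ifP => i0; lia.
- case=> [|i] iL; first by case/andP: iL.
  rewrite !wheel_row /k /=; try lia.
  by case: (eqVneq i 0) => i0; case: ifP => Ei; lia.
- case=> [|i] y iL; first by case/andP: iL.
  move=> Cy; rewrite wheel_row /k /=; last by lia.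
  by case: (eqVneq i 0) => i0; case: ifP => Ei; lia.
- case=> [|i] y iL; first by case/andP: iL.
  move=> Ry; rewrite /k /= => /wheel_col [|->|Ey|->]; first by lia.
  + by constructor 1.
  + constructor 3; split; last by lia.
    have : y != 3 by apply: contraNneq n3 => <-.
    by lia.
  + by constructor 2; lia.
- by move=> i iL; lia.
- case=> [|i] iL; first by case/andP: iL.
  by rewrite /k /=; case: (eqVneq i 0); lia.
- move=> i y iL /E_le2[y1 y2]; split; apply/eqP => Ey; [move: y1|move: y2]; rewrite Ey; first by lia.
  by rewrite /k; case: ifP => i0; lia.
- move=> R C [RR CC out].
  have nR i : 3 < i <= t.+1 -> ~~ R i.
    by move=> it; have /andP[] := out (t.+2 - i) ltac:(lia); rewrite subKn //; lia.
  have nC i : 3 < i <= t -> ~~ C i.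
    move=> it; have /andP[_] := out (t.+1 - i) ltac:(lia).
    by rewrite /k ifN ?subKn //; lia.
  split; apply: wheel_base' => // y; first by right; right.
  by rewrite /add /k /= => /orP[/eqP->|]; [left|right; right].
- by split=> // i /andP[iL]; rewrite leqNgt iL.
Qed.

Lemma wheel_broken x : 1 < x <= t.+1 -> ~~ R0 x -> good (meet g) (sub g R0 C0 E).
Proof.
move=> xt nx; case: (ltngtP x 3) => x3; last by apply: wheel_broken3; rewrite -x3.
  by apply: wheel_broken2; rewrite (_ : 2 = x) //; lia.
by apply: (@wheel_broken_mid x) => //; lia.
Qed.

End Wheel.

(** * Complete rims *)

Lemma good_drop_row g R C E a k :
  (forall y, C y -> g a y -> y = k) -> ~~ E (a, k) ->
  (forall R1 C1, (forall i, R1 i -> R i && (i != a)) -> (forall j, C1 j -> C j) ->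
     good (meet g) (sub g R1 C1 E)) ->
  good (meet g) (sub g R C E).
Proof.
move=> row nE H; case: (boolP [&& R a, C k & g a k]) => [/and3P[Ra Ck gak]|nU].
  by apply: (good_leaf_row Ra Ck gak nE row); apply: H => // j /andP[].
apply: good_ext (H (del a R) C _ _) => // -[i j]; rewrite /sub /del /=.
case Ri: (R i) => //=; case Cj: (C j); rewrite ?andbF //=.
case: (eqVneq i a) => [Ei|//]; case gij: (g i j) => //=; move: gij Ri.
rewrite Ei => gij Ra; have Ej := row j Cj gij.
by move: nU; rewrite Ra -Ej Cj gij.
Qed.

(** All cliques of the cover are full columns, numbered by [c]. *)
Lemma good_columns g R C E A (c : nat -> nat) :
  uniq A -> (forall x, x \in A -> sub g R C E x) -> indep (meet g) A ->
  (forall x, sub g R C E x -> c x.2 < size A) ->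
  (forall x y, sub g R C E x -> sub g R C E y -> c x.2 = c y.2 -> x.2 = y.2) ->
  good (meet g) (sub g R C E).
Proof.
move=> uA AU iA c1 c2; exists A, (fun x => c x.2); split=> //; split=> // x y Ux Uy Ec.
have Exy := c2 _ _ Ux Uy Ec; case/and4P: Ux => _ _ gx _; case/and4P: Uy => _ _ gy _.
by rewrite /meet -Exy gx Exy gy.
Qed.

Lemma indep_cons g x A : (forall y, y \in A -> ~~ meet g x y) ->
  indep (meet g) A -> indep (meet g) (x :: A).
Proof.
move=> xA iA y z; rewrite !inE => /predU1P[->|yA] /predU1P[->|zA]; rewrite ?eqxx //.
- by move=> _; apply: xA.
- by move=> _; rewrite meetC; apply: xA.
- exact: iA.
Qed.

Section Cycle.
Variable t : nat.
Hypothesis t3 : 3 <= t.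
Let g := wheel t.
Variables (R C : pred nat) (E : pred (nat * nat)).
Hypotheses (Rt : forall i, R i -> i <= t.+1) (Ct : forall j, C j -> j <= t).
Hypothesis E_wheel : forall x, E x -> x \in wheel_E.

Definition rim := all R (iota 2 t) && all C (0 :: iota 2 t.-1).

Let nE i j : 1 < j \/ 3 < i -> E (i, j) = false.
Proof.
move=> ij; apply/negP => /E_wheel; rewrite !inE !xpair_eqE.
by case: ij; clear; lia.
Qed.

(** A missing rim column leaves a neighbouring rim row with at most one cell. Dropping this row
    opens the rim, so the case reduces to a missing row. *)
Lemma wheel_not_rim : ~~ rim -> good (meet g) (sub g R C E).
Proof.
have broken := wheel_broken t3.
have bRow x : 1 < x <= t.+1 -> ~~ R x -> good (meet g) (sub g R C E).
  by move=> xt; apply: broken xt.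
have drop x k : 1 < x <= t.+1 -> ~~ E (x, k) -> (forall y, C y -> g x y -> y = k) ->
    good (meet g) (sub g R C E).
  move=> xt nExk row; apply: (good_drop_row row) => // R1 C1 R1R C1C.
  apply: (broken R1 C1 E _ _ _ x) => //; last by apply/negP => /R1R; rewrite eqxx andbF.
  + by move=> i /R1R/andP[/Rt].
  + by move=> j /C1C/Ct.
rewrite /rim negb_and => /orP[/allPn[x]|/allPn[x]].
  by rewrite mem_iota => xt; apply: bRow; move: xt; clear; lia.
rewrite inE mem_iota => /orP[/eqP-> nC|xt nC].
  apply: (drop 3 3); [by move: t3; clear; lia|by rewrite nE //; left|].
  move=> y Cy; rewrite /g /wheel /= => /orP[]/eqP // Ey.
  by move: nC; rewrite -Ey Cy.
have {}xt : 1 < x <= t by move: xt t3; clear; lia.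
have noty y : C y -> y <> x by move=> Cy Ey; move: nC; rewrite -Ey Cy.
case: (eqVneq x 2) => x2.
  apply: (drop t.+1 t); first by move: t3; clear; lia.
    by rewrite nE //; left; move: t3; clear; lia.
  move=> y /noty Cy; rewrite /g wheel_row ?eqxx //; rewrite x2 in Cy.
  by case/orP => /eqP.
apply: (drop x.+1 (if x == t then 2 else x.+1)).
- by move: xt; clear; lia.
- by rewrite nE //; left; case: ifP => _ //; move: xt; clear; lia.
move=> y /noty Cy; rewrite /g wheel_row ?eqSS; last by move: xt x2; clear; lia.
by case/orP => /eqP.
Qed.

Hypothesis full_rim : rim.

Let Rr i : 1 < i <= t.+1 -> R i.
Proof. by case/andP: full_rim => /allP Ra _ it; apply: Ra; rewrite mem_iota; move: it; clear; lia. Qed.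

Let Cc j : j = 0 \/ 1 < j <= t -> C j.
Proof.
case/andP: full_rim => _ /allP Ca [->|jt]; first by apply: Ca; rewrite inE eqxx.
by apply: Ca; rewrite inE mem_iota; move: jt t3; clear; lia.
Qed.

Let C0' : C 0. Proof. by apply: Cc; left. Qed.

Let diag := [seq (i, i) | i <- iota 3 (t - 2)].
Let subdiag := [seq (i.+1, i) | i <- iota 3 (t - 2)].

Let gdiag i j : 2 < i <= t -> g i j ->
  [|| j == i, (3 < i) && (j == i.-1) | (i == 3) && (j == 0)].
Proof.
move=> it; case: (eqVneq i 3) => [->|i3].
  by rewrite /g /wheel /= => /orP[]->; rewrite ?orbT.
have i4 : 3 < i by move: it i3; clear; lia.
rewrite /g wheel_row // ifF; last by move: it; clear; lia.
by rewrite i4; case/orP => ->; rewrite ?orbT.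
Qed.

Let gdiag1 i : 2 < i <= t -> g i i.
Proof.
move=> it; case: (eqVneq i 3) => [->|i3] //.
rewrite /g wheel_row; last by move: it i3; clear; lia.
by rewrite ifF ?eqxx ?orbT //; move: it; clear; lia.
Qed.

Let gsubdiag i j : 2 < i <= t -> g i.+1 j = (j == i) || (j == (if i == t then 2 else i.+1)).
Proof. by move=> it; rewrite /g wheel_row ?eqSS //; move: it; clear; lia. Qed.

Let g2 j : g 2 j = (j <= 2). Proof. by []. Qed.

Let diagP x : x \in diag -> exists2 i, x = (i, i) & 2 < i <= t.
Proof. by case/mapP => i; rewrite mem_iota => it ->; exists i => //; move: it t3; clear; lia. Qed.

Let subdiagP x : x \in subdiag -> exists2 i, x = (i.+1, i) & 2 < i <= t.
Proof. by case/mapP => i; rewrite mem_iota => it ->; exists i => //; move: it t3; clear; lia. Qed.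

Let diagU x : x \in diag -> sub g R C E x.
Proof.
case/diagP => i -> it; rewrite /sub /= gdiag1 // nE; last by left; move: it; clear; lia.
by rewrite Rr ?Cc //; [right|]; move: it; clear; lia.
Qed.

Let lastU : sub g R C E (t.+1, 2).
Proof.
rewrite /sub /= nE; last by left.
rewrite Rr; last by move: t3; clear; lia.
rewrite Cc; last by right; move: t3; clear; lia.
by rewrite gsubdiag ?eqxx ?orbT //; move: t3; clear; lia.
Qed.

Let diag_indep : indep (meet g) ((t.+1, 2) :: diag).
Proof.
apply: indep_cons => [y /diagP[i -> it]|x y /diagP[i -> it] /diagP[j -> jt]].
  rewrite /meet /=; apply/negP => /andP[_ /(gdiag it)].
  by move: it; clear; lia.
rewrite xpair_eqE => ij; rewrite /meet /=; apply/negP => /andP[/(gdiag it) H1 /(gdiag jt) H2].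
by move: it jt ij H1 H2; clear; lia.
Qed.

Let subdiag_indep : indep (meet g) [:: (2, 2), (3, 0) & subdiag].
Proof.
apply: indep_cons => [y|].
  rewrite inE => /predU1P[->|/subdiagP[i -> it]] //.
  by rewrite /meet /= g2; move: it; clear; lia.
apply: indep_cons => [y /subdiagP[i -> it]|x y /subdiagP[i -> it] /subdiagP[j -> jt]].
  rewrite /meet /= (gsubdiag _ it);  apply/negP => /andP[_]; case: ifP => _; move: it; clear; lia.
rewrite xpair_eqE => ij; rewrite /meet /= !gsubdiag //.
by apply/negP; case: ifP => _; case: ifP => _; move: it jt ij; clear; lia.
Qed.

Let size_diag : size diag = t - 2. Proof. by rewrite size_map size_iota. Qed.
Let size_subdiag : size subdiag = t - 2. Proof. by rewrite size_map size_iota. Qed.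

Let uniq_diag : uniq diag.
Proof. by rewrite map_inj_uniq ?iota_uniq // => i j []. Qed.

Let uniq_subdiag : uniq subdiag.
Proof. by rewrite map_inj_uniq ?iota_uniq // => i j []. Qed.

Let Ccol x : sub g R C E x -> ~~ C 1 -> x.2 = 0 \/ 1 < x.2 <= t.
Proof.
case/and4P => _ Cx _ _ C1; have := Ct Cx.
have : x.2 != 1 by apply: contraNneq C1 => <-.
by case: x.2 => [|[|j]] // _ jt; [left|right].
Qed.

Let cc j := if j == 0 then 0 else j.-1.

(** Without column 1 the [t] columns [0, 2, ..., t] cover everything, and the isolated set has one
    cell in each: the diagonal serves [3, ..., t], the closing row [t + 1] serves column 2, and
    [(2, 0)] serves column 0. *)
Lemma rim_good20 : ~~ C 1 -> ~~ E (2, 0) -> good (meet g) (sub g R C E).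
Proof.
move=> C1 E20; apply: (@good_columns _ _ _ _ [:: (2, 0), (t.+1, 2) & diag] cc).
- rewrite /= uniq_diag andbT inE xpair_eqE negb_or andbF /=.
  by apply/andP; split; apply/negP => /diagP[i [] + +]; clear; lia.
- move=> x; rewrite !inE => /or3P[/eqP->|/eqP->|/diagU //]; last exact: lastU.
  by rewrite /sub /= E20 Rr ?C0' //; move: t3; clear; lia.
- apply: indep_cons => [y|]; last exact: diag_indep.
  rewrite inE => /predU1P[->|/diagP[i -> it]].
    have gt0 : g t.+1 0 = false by rewrite gsubdiag ?eqxx; move: t3; clear; lia.
    by rewrite /meet /= gt0 ?andbF.
  by rewrite /meet /= g2; move: it; clear; lia.
- move=> x /Ccol/(_ C1); rewrite /cc /= size_diag; case: ifP => _; move: t3; clear; lia.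
- move=> x y /Ccol/(_ C1) x2 /Ccol/(_ C1) y2; rewrite /cc.
  by move: x2 y2; case: eqP; case: eqP; clear; lia.
Qed.

(** The same cover, with the other choice round the rim: each column is served by its other rim row,
    so that column 0 falls to row 3. *)
Lemma rim_good30 : ~~ C 1 -> ~~ E (3, 0) -> good (meet g) (sub g R C E).
Proof.
move=> C1 E30; apply: (@good_columns _ _ _ _ [:: (2, 2), (3, 0) & subdiag] cc).
- rewrite /= uniq_subdiag andbT inE xpair_eqE negb_or /=.
  by apply/andP; split; apply/negP => /subdiagP[i [] + +]; clear; lia.
- move=> x; rewrite !inE => /or3P[/eqP->|/eqP->|/subdiagP[i -> it]].
  + rewrite /sub /= nE; last by left.
    rewrite Rr; last by move: t3; clear; lia.
    by rewrite Cc //; right; move: t3; clear; lia.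
  + by rewrite /sub /= E30 Rr ?C0' //; move: t3; clear; lia.
  + rewrite /sub /= gsubdiag // eqxx nE; last by left; move: it; clear; lia.
    by rewrite Rr ?Cc //; [right|]; move: it; clear; lia.
- exact: subdiag_indep.
- move=> x /Ccol/(_ C1); rewrite /cc /= size_subdiag; case: ifP => _; move: t3; clear; lia.
- move=> x y /Ccol/(_ C1) x2 /Ccol/(_ C1) y2; rewrite /cc.
  by move: x2 y2; case: eqP; case: eqP; clear; lia.
Qed.

(** Column 0 has ones only in rows 0 to 3. Rows 0 and 1 are absent and the other two cells are
    marked, so nothing in it needs covering and the [t - 1] columns [2, ..., t] suffice. *)
Lemma rim_good_path : ~~ C 1 -> E (2, 0) -> E (3, 0) -> ~~ R 0 -> ~~ R 1 ->
  good (meet g) (sub g R C E).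
Proof.
move=> C1 E20 E30 R0 R1.
have col x : sub g R C E x -> 1 < x.2 <= t.
  move=> Ux; case: (Ccol Ux C1) => // x2; move: Ux; case: x x2 => i j /= ->.
  case/and4P => /= Ri _ gi nEi; exfalso; move: Ri gi nEi.
  case: i => [|[|[|[|i]]]]; rewrite ?(negPf R0) ?(negPf R1) ?E20 ?E30 //.
  by rewrite /g wheel_row //=; case: ifP.
apply: (@good_columns _ _ _ _ ((t.+1, 2) :: diag) (fun j => j - 2)).
- by rewrite /= uniq_diag andbT; apply/negP => /diagP[i [] + +]; clear; lia.
- by move=> x; rewrite inE => /predU1P[->|/diagU].
- exact: diag_indep.
- by move=> x /col; rewrite /= size_diag; clear; lia.
- by move=> x y /col x2 /col y2; move: x2 y2; clear; lia.
Qed.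

End Cycle.

Section Families.
Variables (t : nat) (R C : pred nat) (E : pred (nat * nat)).
Hypothesis t3 : 3 <= t.
Hypotheses (Rt : forall i, R i -> i <= t.+1) (Ct : forall j, C j -> j <= t).

Lemma wheel_good_H : ~~ R 1 -> ~~ C 1 ->
  (forall x, E x -> x \in [:: (3, 0); (2, 0)]) ->
  ~~ [&& rim t R C, R 0, E (3, 0) & E (2, 0)] ->
  good (meet (wheel t)) (sub (wheel t) R C E).
Proof.
move=> R1 C1 E2 nf.
have EW x : E x -> x \in wheel_E.
  by move/E2; rewrite !inE => /orP[]->; rewrite ?orbT.
case: (boolP (rim t R C)) => full_rim; last exact: wheel_not_rim.
move: nf; rewrite full_rim.
case: (boolP (E (2, 0))) => E20; last by move=> _; apply: rim_good20.
case: (boolP (E (3, 0))) => E30; last by move=> _; apply: rim_good30.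
by rewrite !andbT => R0; apply: rim_good_path.
Qed.

(** On a complete rim: if row 1 is missing but column 1 is kept, [(2, 1)] is a leaf whose
    elimination takes row 2 and opens the rim. If both are kept and [(1, 1)] is unmarked,
    eliminating it marks [(2, 0)], and the isolated set through [(3, 0)] still works. *)
Lemma wheel_good_M : ~~ R 0 -> (forall x, E x -> x = (1, 1)) ->
  ~~ [&& rim t R C, R 1, C 1 & E (1, 1)] ->
  good (meet (wheel t)) (sub (wheel t) R C E).
Proof.
move=> R0 E1 nf.
have EW x : E x -> x \in wheel_E by move/E1 => ->.
case: (boolP (rim t R C)) => full_rim; last exact: wheel_not_rim.
have E20 : ~~ E (2, 0) by apply/negP => /E1.
case: (boolP (C 1)) => C1; last exact: rim_good20.
have [R2 C0] : R 2 /\ C 0.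
  case/andP: full_rim => /allP Ra /allP Ca; split; first by apply: Ra; rewrite mem_iota; lia.
  by apply: Ca; rewrite inE eqxx.
have col x : R x -> wheel t x 1 -> x = 2 \/ x = 1.
  move=> Rx; case: (leqP x 3) => x3; last first.
    by rewrite wheel_row //; case: ifP => _; move: x3; clear; lia.
  by case: x x3 Rx => [|[|[|[|x]]]] // _ Rx; [right|left].
have row y : C y -> wheel t 1 y -> y = 0 \/ y = 1.
  by move=> _; case: y => [|[|y]] //; [left|right].
case: (boolP (R 1)) => R1; last first.
  apply: (@good_leaf_col _ _ _ _ 1 2) => //; first by apply/negP => /E1.
    by move=> x Rx /(col _ Rx)[//|Ex]; rewrite -Ex Rx in R1.
  apply: wheel_not_rim => //.
  - by move=> i /andP[/Rt].
  - by move=> i /andP[/Ct].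
  - apply/negP => /andP[/allP/(_ 2) + _]; rewrite mem_iota /del eqxx andbF => H.
    by have : false by apply: H; lia.
have nE11 : ~~ E (1, 1) by move: nf; rewrite full_rim R1 C1.
have EF x : E x = false.
  by apply/negP => Ex; move: nE11; rewrite -(E1 _ Ex) Ex.
apply: (@good_square _ _ _ _ 1 1 2 0) => //.
  by move=> x; rewrite EF.
apply: rim_good30 => //.
- by move=> i /andP[/Ct].
- by move=> x; rewrite /add EF orbF => /eqP->.
- case/andP: full_rim => /allP Ra /allP Ca; apply/andP; split; apply/allP => i it.
    by rewrite /del Ra // ; move: it; rewrite mem_iota; clear; lia.
  by rewrite /del Ca // ; move: it t3; rewrite inE mem_iota; clear; lia.
- by rewrite /del eqxx andbF.
- by rewrite /add EF.
Qed.

End Families.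

(** * The matrices [H_t] and [M_n] *)

Definition img n (c : nat -> nat) C : pred nat :=
  fun a => has (fun j => C j && (c j == a)) (iota 1 n).

Lemma imgP n c C a : reflect (exists2 j, range n j & C j /\ c j = a) (img n c C a).
Proof.
apply: (iffP hasP) => [[j]|[j jn [Cj cj]]].
  by rewrite mem_iota add1n ltnS => jn /andP[Cj /eqP cj]; exists j.
by exists j; rewrite ?mem_iota ?add1n ?ltnS // Cj cj eqxx.
Qed.

Lemma img_inj n (c : nat -> nat) C j : {in range n &, injective c} -> range n j ->
  img n c C (c j) = C j.
Proof.
move=> ci jn; apply/imgP/idP => [[i iN [Ci /ci Ec]]|Cj]; last by exists j.
by rewrite -Ec.
Qed.

(* The relabelling exchanges rows and columns. *)
Lemma good_relabel f g m n (r c : nat -> nat) R C E Q :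
  (forall i j, range m i -> range n j -> f i j = g (c j) (r i)) ->
  {in range m &, injective r} -> {in range n &, injective c} ->
  (forall i, R i -> range m i) -> (forall j, C j -> range n j) ->
  (forall x, E x -> x \in Q) -> (forall x, x \in Q -> range m x.1 /\ range n x.2) ->
  good (meet g) (sub g (img n c C) (img m r R)
                     (fun y => has (fun x => E x && ((c x.2, r x.1) == y)) Q)) ->
  good (meet f) (sub f R C E).
Proof.
move=> fg ri ci Rm Cn EQ Qmn.
have EE i j : range m i -> range n j ->
    has (fun x => E x && ((c x.2, r x.1) == (c j, r i))) Q = E (i, j).
  move=> im jn; apply/hasP/idP => [[[i' j'] xQ /andP[Ex]]|Ex].
    have [im' jn'] := Qmn _ xQ.
    by rewrite xpair_eqE => /andP[/eqP /(ci _ _ jn' jn) <- /eqP /(ri _ _ im' im) <-].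
  by exists (i, j); rewrite ?Ex ?eqxx //; apply: EQ.
apply: (good_transport (h := fun x => (c x.2, r x.1))).
- move=> [i j] /and4P[/= Ri Cj fij nE]; have [im jn] := (Rm _ Ri, Cn _ Cj).
  by rewrite /sub /= !img_inj // Ri Cj -fg // fij EE.
- move=> [i j] [i' j'] /and4P[/= /Rm ? /Cn ? _ _] /and4P[/= /Rm ? /Cn ? _ _].
  by rewrite /meet /= -!fg // andbC.
- move=> [a b] /and4P[/= /imgP[j jn [Cj cj]] /imgP[i im [Ri rb]] gab nE].
  exists (i, j); last by rewrite /= cj rb.
  by move: gab nE; rewrite -cj -rb EE // -fg // /sub /= Ri Cj => -> ->.
Qed.

Lemma indep_size_rows g A s : (forall x, x \in A -> g x.1 x.2 /\ x.1 \in s) ->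
  uniq A -> indep (meet g) A -> size A <= size s.
Proof.
move=> As uA iA; rewrite -(size_map fst); apply: uniq_leq_size.
  rewrite map_inj_in_uniq // => x y xA yA E; apply/eqP/negPn/negP => xy.
  have [gx _] := As _ xA; have [gy _] := As _ yA.
  by have := iA _ _ xA yA xy; rewrite /meet -E gx E gy.
by move=> _ /mapP[x /As[_ xs] ->].
Qed.

Lemma indep_size_cols g A s : (forall x, x \in A -> g x.1 x.2 /\ x.2 \in s) ->
  uniq A -> indep (meet g) A -> size A <= size s.
Proof.
move=> As uA iA; rewrite -(size_map snd); apply: uniq_leq_size.
  rewrite map_inj_in_uniq // => x y xA yA E; apply/eqP/negPn/negP => xy.
  have [gx _] := As _ xA; have [gy _] := As _ yA.
  by have := iA _ _ xA yA xy; rewrite /meet E gy -E gx.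
by move=> _ /mapP[x /As[_ xs] ->].
Qed.

Section H.
Variable t : nat.
Hypothesis t3 : 3 <= t.

Lemma Hf_row i j : 0 < i < t -> Hf t i j = [|| j == 1, j == i.+1 | j == i.+2].
Proof. by move=> it; rewrite /Hf /Cf; case: ifP; move: it; lia. Qed.

Lemma Hf_last j : Hf t t j = [|| j == 1, j == 2 | j == t.+1].
Proof. by rewrite /Hf /Cf; case: ifP; move: t3; lia. Qed.

Let U := sub (Hf t) (range t) (range t.+1) (mem (Gs t)).

Let U_in x : U x -> (0 < x.1 < t /\ [|| x.2 == 1, x.2 == x.1.+1 | x.2 == x.1.+2]) \/ x = (t, 1).
Proof.
case: x => i j /and4P[/= it jt].
case: (eqVneq i t) => [->|it']; last first.
  have {}it : 0 < i < t by move: it it'; rewrite /range; clear; lia.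
  by rewrite Hf_row // => Hij _; left.
rewrite Hf_last /Gs !inE !xpair_eqE !eqxx /=.
by move=> H1 H2; right; congr pair; move: H1 H2; clear; lia.
Qed.

Let U_t1 : U (t, 1).
Proof.
by rewrite /U /sub /= ?Hf_last /Gs !inE !xpair_eqE /range; move: t3; clear; lia.
Qed.

Let U_ij i d : 0 < i < t -> d < 2 -> U (i, i.+1 + d).
Proof.
move=> it d2; rewrite /U /sub /= Hf_row // /Gs !inE !xpair_eqE /range.
by move: it d2; clear; lia.
Qed.

Lemma H_gap : gap (meet (Hf t)) U.
Proof.
apply: (@gap_intro _ _ _ t.-1 (t, 1)) => //.
  move=> A uA AU iA; case: (boolP ((t, 1) \in A)) => tA.
    (* [(t, 1)] is adjacent to every cell in columns 1, 2 and [t + 1], so the rest of [A] lies in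
       columns [3, ..., t]. *)
    have -> : t.-1 = size (1 :: iota 3 (t - 2)) by rewrite /= size_iota; move: t3; clear; lia.
    apply: (indep_size_cols _ uA iA) => x xA; split; first by case/and4P: (AU _ xA).
    case: (eqVneq x (t, 1)) => [->|xt]; first by rewrite inE eqxx.
    have := iA _ _ tA xA; rewrite eq_sym xt => /(_ isT).
    have /and4P[_ x2 _ _] := AU _ xA.
    case: (U_in (AU _ xA)) => [[x1 _]|Ex]; last by rewrite Ex eqxx in xt.
    rewrite /meet /= Hf_last Hf_row // eqxx /= andbT inE mem_iota.
    by move: x2 t3; rewrite /range; clear; lia.
  rewrite -[leqRHS](size_iota 1); apply: (indep_size_rows _ uA iA) => x xA.
  split; first by case/and4P: (AU _ xA).
  case: (U_in (AU _ xA)) => [[x1 _]|Ex]; last by rewrite -Ex xA in tA.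
  by rewrite mem_iota; move: x1; clear; lia.
move=> K KU cK Kt1.
(* Two diagonals of [t - 1] isolated cells, [(i, i + 1)] and [(i, i + 2)]. Only [(1, 2)] on the
   first and [(t - 1, t + 1)] on the second can share a clique with [(t, 1)], and these two are not
   adjacent, so one diagonal avoids [K]. *)
have main d : d < 2 -> (forall i, 0 < i < t -> ~~ K (i, i.+1 + d)) ->
    exists A, [/\ uniq A, forall x, x \in A -> U x && ~~ K x, indep (meet (Hf t)) A & size A = t.-1].
  move=> d2 nK; exists [seq (i, i.+1 + d) | i <- iota 1 t.-1]; split.
  - by rewrite map_inj_uniq ?iota_uniq // => i j [].
  - move=> _ /mapP[i + ->]; rewrite mem_iota => it.
    have {}it : 0 < i < t by move: it t3; clear; lia.
    by rewrite U_ij // nK.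
  - move=> _ _ /mapP[i + ->] /mapP[j + ->]; rewrite !mem_iota xpair_eqE /meet /= => it jt ij.
    rewrite !Hf_row; try by move: it jt t3; clear; lia.
    by move: ij it jt d2; clear; lia.
  - by rewrite size_map size_iota.
have adj i d : 0 < i < t -> d < 2 -> K (i, i.+1 + d) -> i.+1 + d = 2 \/ i.+1 + d = t.+1.
  move=> it d2 /(cK _ _ Kt1) /andP[/=]; rewrite Hf_last => + _.
  by move: it; clear; lia.
case: (boolP (K (1, 2))) => K1; last first.
  apply: (main 0) => // i it; apply/negP => Ki.
  have Ei : i = 1 by case: (adj i 0 it isT Ki); move: it; clear; lia.
  by move: Ki; rewrite Ei (negPf K1).
apply: (main 1) => // i it; apply/negP => Ki.
have Ei : i = t.-1 by case: (adj i 1 it isT Ki); move: it; clear; lia.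
have := cK _ _ K1 Ki; rewrite /meet /= Ei Hf_row; last by move: t3; clear; lia.
by move: t3; clear; lia.
Qed.

Let c j := if j == 1 then 0 else if j == t.+1 then 2 else j.+1.
Let r i := if i == t then 0 else if i == t.-1 then 2 else i.+2.

Let Hf_wheel i j : range t i -> range t.+1 j -> Hf t i j = wheel t (c j) (r i).
Proof.
move=> it jt; rewrite /c; case: (eqVneq j 1) => [->|j1].
  rewrite wheel0 /Hf eqxx /r; case: ifP => // _; by case: ifP.
case: (eqVneq j t.+1) => [->|jt1].
  rewrite /wheel /= /Hf /Cf /r; move: it t3; rewrite /range; clear.
  by case: ifP => // ?; [lia|case: ifP => ?; [lia|case: ifP => ?; lia]].
case: (eqVneq j 2) => [->|j2].
  rewrite /wheel /= /Hf /Cf /= /r; move: it t3; rewrite /range; clear.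
  by case: ifP => ?; [lia|case: ifP => ?; lia].
rewrite wheel_row; last by move: jt j1 j2; rewrite /range; clear; lia.
rewrite /Hf (negPf j1) /Cf /r; move: it jt t3 j1 j2 jt1; rewrite /range; clear.
by case: ifP => ?; [|case: ifP => ?]; (case: ifP => ?; lia).
Qed.

Lemma H_minimally_non_firm : minimally_non_firm (stretch t t.+1 (Gs t) (Hf t)).
Proof.
have Gr x : x \in Gs t -> range t x.1 /\ range t.+1 x.2.
  by rewrite !inE => /orP[]/eqP->; rewrite /range /=; move: t3; clear; lia.
apply: stretch_minimally_non_firm.
- move=> x xG; have [x1 x2] := Gr _ xG; split=> //.
  by move: xG; rewrite !inE => /orP[]/eqP-> /=; rewrite Hf_last eqxx ?orbT.
- by rewrite /= inE xpair_eqE; move: t3; clear; lia.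
- exact: H_gap.
move=> R C E Rt Ct EG nf.
have ri : {in range t &, injective r}.
  move=> i j; rewrite !unfold_in /range /r; move: t3; clear.
  by case: ifP => ?; case: ifP => ?; try (case: ifP => ?); try (case: ifP => ?); lia.
have ci : {in range t.+1 &, injective c}.
  move=> i j; rewrite !unfold_in /range /c; move: t3; clear.
  by case: ifP => ?; case: ifP => ?; try (case: ifP => ?); try (case: ifP => ?); lia.
apply: (good_relabel Hf_wheel ri ci Rt Ct EG Gr); apply: wheel_good_H => //.
- move=> _ /imgP[j jt [_ <-]]; move: jt t3; rewrite /range /c; clear.
  by case: ifP => ?; [lia|case: ifP => ?; lia].
- move=> _ /imgP[j jt [_ <-]]; move: jt t3; rewrite /range /r; clear.
  by case: ifP => ?; [lia|case: ifP => ?; lia].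
- apply/imgP => -[j jt [_]]; move: jt t3; rewrite /range /c; clear.
  by case: ifP => ?; [lia|case: ifP => ?; lia].
- apply/imgP => -[j jt [_]]; move: jt t3; rewrite /range /r; clear.
  by case: ifP => ?; [lia|case: ifP => ?; lia].
- move=> y /hasP[x xG /andP[_ /eqP<-]]; move: xG; rewrite !inE => /orP[]/eqP->; rewrite /c /r /= !eqxx.
    by case: ifP => ? //; move: t3; lia.
  by case: ifP => ? //; move: t3; lia.
apply/negP => /and4P[/andP[/allP Ra /allP Ca] R0' /hasP[x xG /andP[Ex x30]] /hasP[y yG /andP[Ey y20]]].
apply: nf; split.
- move=> i it; rewrite -(img_inj _ ri it); apply: Ca; rewrite inE mem_iota.
  move: it t3; rewrite /range /r; clear.
  by case: ifP => ?; [lia|case: ifP => ?; lia].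
- move=> j jt; rewrite -(img_inj _ ci jt).
  case: (eqVneq j 1) => [->|j1]; first exact: R0'.
  apply: Ra; rewrite mem_iota; move: jt j1 t3; rewrite /range /c; clear.
  by case: ifP => ?; [lia|case: ifP => ?; lia].
- have c2 : c 2 = 3 by rewrite /c /= ifF //; move: t3; clear; lia.
  have ct : c t.+1 = 2 by rewrite /c ifF ?eqxx //; move: t3; clear; lia.
  have xE : x = (t, 2).
    by move: xG x30; rewrite !inE => /orP[]/eqP-> //=; rewrite ct.
  have yE : y = (t, t.+1).
    by move: yG y20; rewrite !inE => /orP[]/eqP-> //=; rewrite c2.
  by move=> z; rewrite !inE => /orP[]/eqP->; rewrite -?xE -?yE.
Qed.

End H.

Section M.
Variable t : nat.
Hypothesis t3 : 3 <= t.
Let n := t.+1.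

Lemma MfE i j : range n i -> range n j -> Mf n i j =
  [|| (i < t) && ((j == i) || (j == i.+1)), (i == t) && [|| j == 1, j == t | j == n]
    | (i == n) && ((j == t) || (j == n))].
Proof.
rewrite /range /n => it jt; rewrite /Mf /stretchf /=.
case: (leqP i t) => i1; case: (leqP j t) => j1.
- by rewrite /Cf; move: t3 it jt i1 j1; clear; lia.
- by have -> : j = t.+1 by [lia]; rewrite subSnn /=; move: t3 it i1; clear; lia.
- by have -> : i = t.+1 by [lia]; rewrite subSnn /=; move: t3 jt j1; clear; lia.
- have -> : i = t.+1 by lia.
  by have -> : j = t.+1 by [lia]; rewrite !subSnn /=; move: t3; clear; lia.
Qed.

Let f := Mf n.
Let U := sub f (range n) (range n) (mem [:: (n, n)]).

Let U_in x : U x -> range n x.1 /\ range n x.2 /\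
  [|| (x.1 < t) && ((x.2 == x.1) || (x.2 == x.1.+1)),
      (x.1 == t) && [|| x.2 == 1, x.2 == t | x.2 == n] | (x.1 == n) && (x.2 == t)].
Proof.
case: x => i j /and4P[ir jr fij nQ].
have H2 : (i, j) != (n, n) by move: nQ; rewrite /= inE.
move: fij H2; rewrite [f _ _](MfE ir jr) xpair_eqE => /= H1 H2; do 2 split=> //=.
by move: H1 H2; clear; lia.
Qed.

Let U_mk i j : range n i -> range n j -> f i j -> (i, j) != (n, n) -> U (i, j).
Proof. by move=> ir jr fij ne; rewrite /U /sub /= ir jr fij inE. Qed.

Lemma M_gap : gap (meet f) U.
Proof.
have rt : range n t by rewrite /range /n; move: t3; clear; lia.
have rn : range n n by rewrite /range /n; move: t3; clear; lia.
have r1 : range n 1 by rewrite /range /n; move: t3; clear; lia.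
apply: (@gap_intro _ _ _ t (t, n)).
- move=> A uA AU iA; case: (boolP ((n, t) \in A)) => tA.
    (* The only cell of column [n] is [(t, n)], which is adjacent to [(n, t)]; the set therefore
       fits into [t] columns. Without [(n, t)], the only cell of row [n], it fits into [t] rows. *)
    rewrite -[leqRHS](size_iota 1); apply: (indep_size_cols _ uA iA) => x xA.
    split; first by case/and4P: (AU _ xA).
    have [x1 [x2 xE]] := U_in (AU _ xA).
    rewrite mem_iota; case: (eqVneq x.2 n) => [x2n|x2n]; last by move: x2 x2n; rewrite /range /n; clear; lia.
    have x1t : x.1 = t by move: xE x2n; rewrite /n; clear; lia.
    have : (n, t) != x by apply/eqP => E; move: x1t; rewrite -E /= /n; clear; lia.
    move/(iA _ _ tA xA); rewrite /meet /= x2n x1t /f !MfE //.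
    by move: t3; rewrite /n; clear; lia.
  rewrite -[leqRHS](size_iota 1); apply: (indep_size_rows _ uA iA) => x xA.
  split; first by case/and4P: (AU _ xA).
  have [x1 [x2 xE]] := U_in (AU _ xA); rewrite mem_iota.
  have : x.1 != n.
    apply: contra tA => /eqP x1n; have x2t : x.2 = t by move: xE x1n; rewrite /n; clear; lia.
    by rewrite -x1n -x2t -surjective_pairing.
  by move: x1; rewrite /range /n; clear; lia.
- apply: U_mk => //; first by rewrite /f MfE // !eqxx !orbT.
  by rewrite xpair_eqE /n; clear; lia.
move=> K KU cK Ktn.
have nearK x : K x -> f t x.2 && f x.1 n by move=> Kx; have := cK _ _ Ktn Kx.
(* A clique through [(t, n)] lives in rows [t] and [n], so the diagonals [(i, i)] and [(i, i + 1)]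
   with [i < t] avoid it. The first is completed by [(n, t)], the second by [(t, 1)]; these two are
   not adjacent, so [K] spares one of them. *)
have main d y : d < 2 -> U y -> ~~ K y -> (forall i, 0 < i < t -> ~~ meet f y (i, i + d)) ->
    exists A, [/\ uniq A, forall x, x \in A -> U x && ~~ K x, indep (meet f) A & size A = t].
  move=> d2 Uy nKy ny; exists (y :: [seq (i, i + d) | i <- iota 1 t.-1]).
  have iP x : x \in [seq (i, i + d) | i <- iota 1 t.-1] -> exists2 i, 0 < i < t & x = (i, i + d).
    by case/mapP => i; rewrite mem_iota => it ->; exists i => //; move: it t3; clear; lia.
  have rng i : 0 < i < t -> range n i /\ range n (i + d).
    by rewrite /range /n; move: d2; clear; lia.
  split.
  - rewrite /= map_inj_uniq ?iota_uniq ?andbT; last by move=> i j [].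
    apply/negP => /iP[i /ny + E]; rewrite -E; have /and4P[_ _ fy _] := Uy.
    by rewrite /meet fy.
  - move=> x; rewrite inE => /predU1P[->|/iP[i it ->]]; first by rewrite Uy nKy.
    have [i1 i2] := rng _ it; apply/andP; split.
      apply: U_mk => //; first by rewrite /f MfE //; move: it d2; clear; lia.
      by rewrite xpair_eqE /n; move: it; clear; lia.
    apply/negP => /nearK/andP[_]; rewrite /f MfE //= /n; move: it; clear; lia.
  - apply: indep_cons => [x /iP[i it ->]|]; first exact: ny.
    move=> _ _ /iP[i it ->] /iP[j jt ->]; rewrite xpair_eqE /meet /= => ij.
    have [[i1 i2] [j1 j2]] := (rng _ it, rng _ jt).
    by rewrite /f !MfE // /n; move: it jt d2 ij; clear; lia.
  - by rewrite /= size_map size_iota; move: t3; clear; lia.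
case: (boolP (K (t, 1))) => K1.
  apply: (main 0 (n, t)) => //.
  - apply: U_mk => //; first by rewrite /f MfE // !eqxx !orbT.
    by rewrite xpair_eqE /n; clear; lia.
  - apply/negP => Knt; have := cK _ _ K1 Knt; rewrite /meet /= /f !MfE // /n.
    by move: t3; clear; lia.
  - move=> i it; have ir : range n i by rewrite /range /n; move: it; clear; lia.
    by rewrite /meet /= addn0 /f !MfE // /n; move: it; clear; lia.
apply: (main 1 (t, 1)) => //.
- apply: U_mk => //; first by rewrite /f MfE // !eqxx !orbT.
  by rewrite xpair_eqE /n; clear; lia.
- move=> i it; have ir : range n i by rewrite /range /n; move: it; clear; lia.
  have jr : range n (i + 1) by rewrite /range /n; move: it; clear; lia.
  by rewrite /meet /= /f !MfE // /n; move: it t3; clear; lia.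
Qed.

Let c j := if j == n then 1 else if j == t then 2 else j.+2.
Let r i := if i == n then 1 else if i == t then 0 else if i == t.-1 then 2 else i.+2.

Let Mf_wheel i j : range n i -> range n j -> Mf n i j = wheel t (c j) (r i).
Proof.
move=> ir jr; rewrite MfE // /c.
case: (eqVneq j n) => [->|jn].
  rewrite /wheel /= /r; move: ir t3; rewrite /range /n; clear.
  by case: ifP => ?; [lia|case: ifP => ?; [lia|case: ifP => ?; lia]].
case: (eqVneq j t) => [->|jt].
  rewrite /wheel /= /r; move: ir t3; rewrite /range /n; clear.
  by case: ifP => ?; [lia|case: ifP => ?; [lia|case: ifP => ?; lia]].
case: (eqVneq j 1) => [->|j1].
  rewrite /wheel /= /r; move: ir t3; rewrite /range /n; clear.
  by case: ifP => ?; [lia|case: ifP => ?; [lia|case: ifP => ?; lia]].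
rewrite wheel_row; last by move: jr j1; rewrite /range; clear; lia.
rewrite /r; move: ir jr t3 j1 jt jn; rewrite /range /n; clear.
by case: ifP => ?; [|case: ifP => ?; [|case: ifP => ?]]; (case: ifP => ?; lia).
Qed.

Lemma M_minimally_non_firm : minimally_non_firm (stretch n n [:: (n, n)] (Mf n)).
Proof.
have rn : range n n by rewrite /range /n; move: t3; clear; lia.
have Qr x : x \in [:: (n, n)] -> range n x.1 /\ range n x.2 by rewrite inE => /eqP->.
apply: stretch_minimally_non_firm => //.
- by move=> x; rewrite inE => /eqP->; rewrite MfE // !eqxx !orbT.
- exact: M_gap.
move=> R C E Rt Ct EG nf.
have ri : {in range n &, injective r}.
  move=> i j; rewrite !unfold_in /range /r /n; move: t3; clear.
  by do 6 (case: ifP => ?; try lia).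
have ci : {in range n &, injective c}.
  move=> i j; rewrite !unfold_in /range /c /n; move: t3; clear.
  by do 4 (case: ifP => ?; try lia).
have cn : c n = 1 by rewrite /c eqxx.
have rn1 : r n = 1 by rewrite /r eqxx.
apply: (good_relabel Mf_wheel ri ci Rt Ct EG Qr); apply: wheel_good_M => //.
- move=> _ /imgP[j jt [_ <-]]; move: jt t3; rewrite /range /c /n; clear.
  by case: ifP => ?; [lia|case: ifP => ?; lia].
- move=> _ /imgP[j jt [_ <-]]; move: jt t3; rewrite /range /r /n; clear.
  by do 3 (case: ifP => ?; try lia).
- apply/imgP => -[j jt [_]]; move: jt t3; rewrite /range /c /n; clear.
  by case: ifP => ?; [lia|case: ifP => ?; lia].
- by move=> y /hasP[x + /andP[_ /eqP<-]]; rewrite inE => /eqP->; rewrite /= cn rn1.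
apply/negP => /and4P[/andP[/allP Ra /allP Ca] R1 C1 /hasP[x xG /andP[Ex _]]].
apply: nf; split.
- move=> i it; rewrite -(img_inj _ ri it); case: (eqVneq i n) => [->|ne]; first by rewrite rn1.
  apply: Ca; rewrite inE mem_iota; move: it ne t3; rewrite /range /r /n; clear.
  by do 3 (case: ifP => ?; try lia).
- move=> j jt; rewrite -(img_inj _ ci jt); case: (eqVneq j n) => [->|ne]; first by rewrite cn.
  apply: Ra; rewrite mem_iota; move: jt ne t3; rewrite /range /c /n; clear.
  by do 2 (case: ifP => ?; try lia).
- move=> z; rewrite inE => /eqP->; by move: xG; rewrite inE => /eqP <-.
Qed.

End M.

(** * Total balance *)

Implicit Types (Ru Cu : nat -> Prop).

Lemma tail_unused g s n Ru Cu :
  1 < s ->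
  (forall i j, s < i -> g i j = (j == i.-1) || (j == i)) ->
  (forall i j, 0 < i <= s -> s < j -> g i j = (i == s)) -> g s s ->
  (forall i, Ru i -> range n i) -> (forall j, Cu j -> range n j) -> cyclic g Ru Cu ->
  forall i, s < i -> ~ Ru i /\ ~ Cu i.
Proof.
move=> s1 g_tail g_center gss Rn Cn cyc i si.
have [d dn] : exists d, n < i + d by exists n.+1; lia.
elim: d i si dn => [|d IH] i si dn.
  by split=> [/Rn|/Cn] /andP[_]; rewrite leqNgt; move: dn; rewrite addn0 => ->.
have [nR _] := IH i.+1 (leqW si) ltac:(lia).
apply: (cyclic_corner cyc (l := s) (k := i.-1)).
- by move=> y _; rewrite g_tail // => /orP[]/eqP; [left|right].
- move=> x Rx gx; have /andP[x0 _] := Rn _ Rx.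
  case: (g_big_col (ltnW s1) g_tail g_center gss x0 si gx); [by left|by right|].
  by move=> Ex; case: nR; rewrite -Ex.
- case: (eqVneq i.-1 s) => [-> //|ne]; rewrite g_center ?eqxx //; last by lia.
  by rewrite leqnn andbT ltnW.
Qed.

Lemma tail_totally_balanced f g s n :
  1 < s -> s < n ->
  (forall i j, s < i -> g i j = (j == i.-1) || (j == i)) ->
  (forall i j, 0 < i <= s -> s < j -> g i j = (i == s)) ->
  g s s -> g 1 2 -> g 2 1 ->
  (forall i j, range n i -> range n j -> g i j = f i j) ->
  (forall Ru Cu, (forall i, Ru i -> range s i) -> (forall j, Cu j -> range s j) ->
     ~ cyclic g Ru Cu) ->
  totally_balanced (stretch n n (Qs n) f).
Proof.
move=> s1 sn g_tail g_center gss g12 g21 fg base.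
apply: stretch_not_cyclic.
- move=> x; rewrite !inE => /or3P[]/eqP-> /=; rewrite -fg /range; try by lia.
  + by rewrite g12; split=> //; lia.
  + by rewrite g21; split=> //; lia.
  + by rewrite g_tail // eqxx orbT; split=> //; lia.
- by rewrite /= !inE !xpair_eqE; lia.
move=> Ru Cu Rn Cn cyc'.
have cyc : cyclic g Ru Cu.
  by apply: cyclic_agree cyc' => i j /Rn ri /Cn rj; rewrite fg.
have out := tail_unused s1 g_tail g_center gss Rn Cn cyc.
apply: (base Ru Cu _ _ cyc) => i ui.
  have /andP[i0 _] := Rn _ ui; rewrite /range i0 leqNgt; apply/negP => /out[]; by [].
have /andP[i0 _] := Cn _ ui; rewrite /range i0 leqNgt; apply/negP => /out[_]; by [].
Qed.

Lemma D_totally_balanced n : 4 <= n -> totally_balanced (stretch n n (Qs n) (Df n)).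
Proof.
move=> hn; apply: (@tail_totally_balanced _ Dg 3) => //.
- by move=> i j i3; rewrite /Dg /Df; lia.
- by move=> i j i3 j3; rewrite /Dg /Df; lia.
- by move=> i j; rewrite /range /Dg /Df; lia.
move=> Ru Cu R3 C3 [H1 _ H3 [a [b [c [[Ra Rb Rc] [ab ac bc]]]]]].
(* Three distinct rows among the first three are all of them. Row 3 has ones wherever row 2 has, so
   the two used ones of row 2 complete to a forbidden square. *)
have [R2 R3'] : Ru 2 /\ Ru 3.
  move: (R3 _ Ra) (R3 _ Rb) (R3 _ Rc); rewrite /range.
  case: a ab ac Ra => [|[|[|[|a]]]] ab ac Ra //=; case: b ab bc Rb => [|[|[|[|b]]]] ab bc Rb //=;
  by case: c ac bc Rc => [|[|[|[|c]]]] ac bc Rc.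
have [y [y' [yy Cy Cy' /andP[gy gy']]]] := H1 2 R2.
have := H3 2 3 y y' R2 R3' Cy Cy' (ltac:(by []) : 2 <> 3) yy; rewrite gy gy' /=.
by have := (C3 _ Cy, C3 _ Cy') => -[/andP[y0 y3] /andP[y0' y3']]; rewrite /Dg /Df; lia.
Qed.

Lemma T_totally_balanced n : 4 <= n ->
  totally_balanced (stretch n.+1 n.+1 (Qs n.+1) (Tf n.+1)).
Proof.
move=> hn; apply: (@tail_totally_balanced _ Tg 4) => //.
- by move=> i j i3; rewrite /Tg /Tf; lia.
- by move=> i j i3 j3; rewrite /Tg /Tf; lia.
- by move=> i j; rewrite /range /Tg /Tf; lia.
move=> Ru Cu R4 C4 cyc.
(* Cells [(2, 1)] and [(1, 2)] are corners, opposite to the ones at [(4, 3)] and [(3, 4)].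
   Discarding their rows leaves two rows, while [C_t] needs three. *)
have [nR2 _] : ~ Ru 2 /\ ~ Cu 1.
  apply: (cyclic_corner cyc (l := 4) (k := 3)) => // [y|x].
    by move/C4; rewrite /range; case: y => [|[|[|[|[|y]]]]] //; [right|left].
  by move/R4; rewrite /range; case: x => [|[|[|[|[|x]]]]] //; [right|left].
have [nR1 _] : ~ Ru 1 /\ ~ Cu 2.
  apply: (cyclic_corner cyc (l := 3) (k := 4)) => // [y|x].
    by move/C4; rewrite /range; case: y => [|[|[|[|[|y]]]]] //; [right|left].
  by move/R4; rewrite /range; case: x => [|[|[|[|[|x]]]]] //; [right|left].
have R34 i : Ru i -> i = 3 \/ i = 4.
  move=> Ri; have := R4 _ Ri; rewrite /range.
  by case: i Ri => [|[|[|[|[|i]]]]] Ri //; [left|right].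
case: cyc => _ _ _ [a [b [c [[/R34 Ra /R34 Rb /R34 Rc] []]]]].
by case: Ra => ->; case: Rb => ->; case: Rc => ->.
Qed.

Theorem theorem4 (n : nat) (hn : 4 <= n) :
  [/\ minimally_non_firm (stretch n n [:: (n, n)] (Mf n)),
      minimally_non_firm (stretch n.-1 n (Gs n.-1) (Hf n.-1)),
      minimally_non_firm (stretch n n (Qs n) (Df n))
    & minimally_non_firm (stretch n.+1 n.+1 (Qs n.+1) (Tf n.+1))] /\
  (totally_balanced (stretch n n (Qs n) (Df n)) /\
   totally_balanced (stretch n.+1 n.+1 (Qs n.+1) (Tf n.+1))).
Proof.
split; last by split; [exact: D_totally_balanced|exact: T_totally_balanced].
split; [| |exact: D_minimally_non_firm|exact: T_minimally_non_firm].
- have n1 : 3 <= n.-1 by lia.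
  by have := M_minimally_non_firm n1; rewrite prednK //; lia.
- have n1 : 3 <= n.-1 by lia.
  by have := H_minimally_non_firm n1; rewrite prednK //; lia.
Qed.
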